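(* Let $m>n\ge 2$ be integers. The functions $\theta_H$ and $\theta_V$ are right-continuous and non-decreasing on $[0,1]$. If $0\le p<p_C$ then $\theta_H(p)=\theta_V(p)=0$, and if $p_C\le p\le 1$ then $\theta_H(p)>0$ and $\theta_V(p)>0$.
   Context: Fix integers $m>n\ge 2$. For $k\ge 1$ the level-$k$ rectangles are the $(mn)^k$ closed rectangles $[an^{-k},(a+1)n^{-k}]\times[bm^{-k},(b+1)m^{-k}]$ with $0\le a\le n^k-1$, $0\le b\le m^k-1$, which tile $[0,1]^2$. Given a probability $p\in[0,1]$, each level-$k$ rectangle, for every $k\ge1$, is selected with probability $p$, independently of all other rectangles of all levels (whether or not the rectangles of lower level containing it are selected). Let $S_j$ be the union of the selected level-$j$ rectangles, $E_k=\bigcap_{j=1}^k S_j$ and $F=\bigcap_{j=1}^\infty S_j=\bigcap_{k=1}^\infty E_k$, a random compact subset of $[0,1]^2$ (the statistically self-affine carpet). Two sets $A,B\subset\mathbb{R}^2$ are connected in a set $F\subset\mathbb{R}^2$ if there are points $x_1\in A\cap F$, $x_2\in B\cap F$ lying in the same connected component of $F$. $F$ is a horizontal (H-) crossing of $[0,1]^2$ if $\{0\}\times[0,1]$ and $\{1\}\times[0,1]$ are connected in $F$, and a vertical (V-) crossing if $[0,1]\times\{0\}$ and $[0,1]\times\{1\}$ are connected in $F$. $\theta_H(p)$ and $\theta_V(p)$ denote the probabilities that $F$ has a horizontal, respectively vertical, crossing of $[0,1]^2$. The critical probabilities $p_H,p_V\in(0,1)$ are the numbers such that $\theta_H(p)=0$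 for $0\le p<p_H$ and $\theta_H(p)>0$ for $p_H<p\le 1$, and $\theta_V(p)=0$ for $0\le p<p_V$ and $\theta_V(p)>0$ for $p_V<p\le1$. These two numbers coincide, and $p_C:=p_H=p_V$ denotes the common value. *)

(* Defs.v *)
From HB Require Import structures.
From mathcomp Require Import all_boot all_order all_algebra finmap.
From mathcomp Require Import all_classical all_reals all_analysis.

Set Implicit Arguments.
Unset Strict Implicit.
Unset Printing Implicit Defensive.

Import Order.TTheory GRing.Theory Num.Theory.
Import numFieldNormedType.Exports.

Local Open Scope classical_set_scope.
Local Open Scope ring_scope.

(* Mutual independence of the events A i for i in D: the product rule over
   every finite subfamily. *)
Definition mutually_independent (R : realType) (d : measure_display)
    (T : measurableType d) (P : probability T R)
    (I : choiceType) (D : set I) (A : I -> set T) : Prop :=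
  forall J : {fset I}, [set` J] `<=` D ->
    P (\bigcap_(i in [set` J]) A i) = (\prod_(i <- J) P (A i))%E.

(* A triple (k, a, b) names the level-k rectangle in column a and row b; only
   the triples in [rect_index n m] name a rectangle of the tiling. *)
Definition rect_index (n m : nat) : set (nat * nat * nat) :=
  [set i | [/\ (1 <= i.1.1)%N, (i.1.2 < n ^ i.1.1)%N & (i.2 < m ^ i.1.1)%N]].

Definition rectangle (R : realType) (n m : nat) (i : nat * nat * nat) :
    set (R * R) :=
  let: (k, a, b) := i in
  `[a%:R * n%:R ^- k, a.+1%:R * n%:R ^- k] `*`
  `[b%:R * m%:R ^- k, b.+1%:R * m%:R ^- k].

(* [sel i] is the event that rectangle i is selected; its values outside
   [rect_index n m] play no role. *)
Definition random_selection (R : realType) (n m : nat) (p : R)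
    (d : measure_display) (T : measurableType d) (P : probability T R)
    (sel : nat * nat * nat -> set T) : Prop :=
  [/\ forall i, rect_index n m i -> measurable (sel i),
      forall i, rect_index n m i -> P (sel i) = p%:E
    & mutually_independent P (rect_index n m) sel].

Definition selected_union (R : realType) (n m : nat) (T : Type)
    (sel : nat * nat * nat -> set T) (j : nat) (w : T) : set (R * R) :=
  \bigcup_(i in [set i | [/\ rect_index n m i, i.1.1 = j & sel i w]])
    rectangle n m i.

Definition carpet (R : realType) (n m : nat) (T : Type)
    (sel : nat * nat * nat -> set T) (w : T) : set (R * R) :=
  \bigcap_(j in [set j | (1 <= j)%N]) selected_union n m sel j w.

Definition connected_in (R : realType) (F A B : set (R * R)) : Prop :=
  exists x1 x2 : R * R,
    [/\ (A `&` F) x1, (B `&` F) x2 & connected_component F x1 x2].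

Definition H_crossing (R : realType) (F : set (R * R)) : Prop :=
  connected_in F ([set 0] `*` `[0, 1]) ([set 1] `*` `[0, 1]).

Definition V_crossing (R : realType) (F : set (R * R)) : Prop :=
  connected_in F (`[0, 1] `*` [set 0]) (`[0, 1] `*` [set 1]).

(* For each p, the carpet lives on its own probability space (T p, P p), with
   selection events [sel p]. *)
Definition theta_H (R : realType) (n m : nat) (d : R -> measure_display)
    (T : forall p : R, measurableType (d p))
    (P : forall p : R, probability (T p) R)
    (sel : forall p : R, nat * nat * nat -> set (T p)) (p : R) : R :=
  fine (P p [set w | H_crossing (carpet n m (sel p) w : set (R * R))]).

Definition theta_V (R : realType) (n m : nat) (d : R -> measure_display)
    (T : forall p : R, measurableType (d p))
    (P : forall p : R, probability (T p) R)
    (sel : forall p : R, nat * nat * nat -> set (T p)) (p : R) : R :=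
  fine (P p [set w | V_crossing (carpet n m (sel p) w : set (R * R))]).

Definition is_critical_probability (R : realType) (theta : R -> R) (pc : R) :
    Prop :=
  [/\ 0 < pc < 1,
      forall p, 0 <= p < pc -> theta p = 0
    & forall p, pc < p <= 1 -> 0 < theta p].

Definition right_continuous_on01 (R : realType) (theta : R -> R) : Prop :=
  forall p, 0 <= p < 1 -> theta x @[x --> p^'+] --> theta p.

(* Main.v *)
Require Import Defs.
From HB Require Import structures.
From mathcomp Require Import all_boot all_order all_algebra finmap.
From mathcomp Require Import all_classical all_reals all_analysis.
From mathcomp Require Import ring lra zify.

(** Only the positivity of theta_H and theta_V at p_C is not a soft fact: both
    are decreasing limits of crossing probabilities of finite approximations,
    which are nondecreasing and continuous in p.

    Finite size criterion.  If the carpet crosses a box one cell wide and two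
    cells high from left to right, then, one level deeper, it crosses each of
    two columns of 2m cells, which happens independently; such a crossing of a
    column crosses a pair of vertically adjacent cells from left to right or a
    cell from bottom to top.  Hence the sum of the probabilities of these two
    kinds of crossings tends to 0 as soon as it is small at some level.  So it
    stays bounded below for p > p_C, and by continuity also at p_C: one of the
    two kinds of crossings has positive probability at p_C.

    Duality.  For p < 1 a horizontal crossing of positive probability forces
    the vertical crossing of the unit square to have positive probability, and
    conversely.  Otherwise all subcrossings would be nearly level, and the
    carpet would contain a horizontal segment, which costs rho^(n^K) against
    only m^K positions.  So a sloped crossing, from row a to row b > a + 2,
    has positive probability.  By Harris' inequality this crossing, its mirror
    image and their vertical translates occur together, and by planarity they
    form one cluster, which is arbitrarily long in the vertical direction.

    A point on a grid line belongs to rectangles on both sides of it, and may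
    use different sides at different levels.  The approximations are therefore
    described by the open faces of all dimensions of the level-k subdivision,
    on which touching closed faces are connected by king moves. *)

Set Implicit Arguments.
Unset Strict Implicit.
Unset Printing Implicit Defensive.

Local Open Scope classical_set_scope.
Local Open Scope nat_scope.

(** * King paths *)

Section KingPaths.

Implicit Types (u v w : nat * nat) (A B : pred (nat * nat)).

Definition king u v :=
  [&& u.1 <= v.1.+1, v.1 <= u.1.+1, u.2 <= v.2.+1 & v.2 <= u.2.+1].

Lemma king_sym u v : king u v = king v u.
Proof. by rewrite /king; lia. Qed.

Definition conn A u v :=
  exists p, [/\ path king u p, all A (u :: p) & last u p = v].

Lemma conn_path_mem A u p v :
  path king u p -> all A (u :: p) -> v \in u :: p -> conn A u v.
Proof.
move=> pp Ap vp; case/splitPl: vp pp Ap => p1 p2 l1.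
by rewrite cat_path -cat_cons all_cat => /andP[pp _] /andP[Ap _]; exists p1.
Qed.

Lemma conn_refl A u : A u -> conn A u u.
Proof. by move=> Au; exists [::]; rewrite /= Au. Qed.

Lemma conn_rcons A u v w : conn A u v -> king v w -> A w -> conn A u w.
Proof.
move=> [p [pp Ap lp]] vw Aw; exists (rcons p w).
by rewrite rcons_path last_rcons -rcons_cons all_rcons pp Ap lp Aw vw.
Qed.

Lemma conn_ind A u (P : nat * nat -> Prop) : P u ->
  (forall v w, conn A u v -> P v -> king v w -> A w -> P w) ->
  forall v, conn A u v -> P v.
Proof.
move=> Pu step v [p].
elim/last_ind: p v => [|p w IH] v [] /=; first by move=> _ _ <-.
rewrite rcons_path last_rcons all_rcons => /andP[pp lw] /and3P[Au Aw Ap] <-.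
have cl : conn A u (last u p) by exists p; rewrite /= Au Ap.
by apply: (step (last u p)) => //; apply: IH; rewrite /= Au Ap.
Qed.

Lemma conn_in A u v : conn A u v -> A u /\ A v.
Proof.
move=> uv; have Au : A u by case: uv => p [_ /andP[]].
by split=> //; move: v uv; apply: conn_ind.
Qed.

Lemma conn_trans A u v w : conn A u v -> conn A v w -> conn A u w.
Proof.
by move=> uv; move: w; apply: conn_ind => // w z _; apply: conn_rcons.
Qed.

Lemma conn_sym A u v : conn A u v -> conn A v u.
Proof.
move=> uv; have [Au _] := conn_in uv.
move: v uv; apply: conn_ind => [|v w uv vu vw Aw]; first exact: conn_refl.
apply: conn_trans vu; apply: (conn_rcons (conn_refl Aw)).
  by rewrite king_sym.
by case: (conn_in uv).
Qed.

Lemma conn_map A B (f : nat * nat -> nat * nat) u v :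
  (forall w, A w -> B (f w)) ->
  (forall w z, A w -> A z -> king w z -> king (f w) (f z)) ->
  conn A u v -> conn B (f u) (f v).
Proof.
move=> AB fk uv; have [Au _] := conn_in uv.
move: v uv; apply: conn_ind => [|v w uv fuv vw Aw]; first exact/conn_refl/AB.
apply: conn_rcons fuv _ (AB _ Aw); apply: fk => //.
by case: (conn_in uv).
Qed.

Lemma conn_sub A B u v : (forall w, A w -> B w) -> conn A u v -> conn B u v.
Proof. by move=> AB; apply: (@conn_map A B id). Qed.

(** Every cell of a path is itself reachable, so a property of all reachable cells holds along the
    path. This confines a cluster to a band that it is known not to leave. *)
Lemma conn_component A B u v :
  (forall w, conn A u w -> B w) -> conn A u v -> conn B u v.
Proof.
move=> AB uv; have [Au _] := conn_in uv.
move: v uv; apply: conn_ind => [|v w uv cuv vw Aw].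
  exact/conn_refl/AB/conn_refl.
by apply: (conn_rcons cuv vw); apply/AB/(conn_rcons uv vw Aw).
Qed.

Section Subcrossing.

Variable f : nat * nat -> nat.
Hypothesis f_king : forall v w, king v w -> f w <= (f v).+1.

(** A king step raises [f] by at most one, so the path cannot jump over the level [hi]; it is cut at
    its first arrival there. *)
Lemma conn_first_hit A hi u v : conn A u v -> f u <= hi <= f v ->
  exists2 w, f w = hi & conn [pred z | A z && (f z <= hi)] u w.
Proof.
move=> uv /andP[uhi hiv].
pose C := conn [pred z | A z && (f z <= hi)] u.
have [Au _] := conn_in uv.
have : (exists2 w, f w = hi & C w) \/ (f v < hi /\ C v).
  have cu : C u by apply: conn_refl; rewrite /= Au.
  move: v uv {hiv}; apply: conn_ind.
    by move: uhi; rewrite leq_eqVlt => /orP[/eqP uhi|]; [left; exists u|right].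
  move=> v w uv [H|[vhi Cv]] vw Aw; first by left.
  have whi : f w <= hi by have := f_king vw; lia.
  have Cw : C w by apply: conn_rcons Cv vw _; rewrite /= Aw.
  by move: whi; rewrite leq_eqVlt => /orP[/eqP whi|]; [left; exists w|right].
by case=> // -[]; lia.
Qed.

(** Discrete intermediate values. The invariant along the path: a crossing of the strip is already
    complete, or the current cell is below [lo], or it is below [hi] and joined within the strip to
    a cell at level [lo]. *)
Lemma conn_crossing A lo hi u v : conn A u v -> lo <= hi ->
    f u <= lo -> hi <= f v ->
  exists u' v', [/\ f u' = lo, f v' = hi &
    conn [pred z | A z && (lo <= f z <= hi)] u' v'].
Proof.
move=> uv lohi ulo hiv; pose B := [pred z | A z && (lo <= f z <= hi)].
have [Au _] := conn_in uv.
have : (exists u' v', [/\ f u' = lo, f v' = hi & conn B u' v']) \/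
    (f v < lo \/ (f v < hi /\ exists2 u', f u' = lo & conn B u' v)).
  have start w : A w -> f w = lo ->
    (exists u' v', [/\ f u' = lo, f v' = hi & conn B u' v']) \/
    (f w < lo \/ (f w < hi /\ exists2 u', f u' = lo & conn B u' w)).
    move=> Aw wlo; have Bw : conn B w w by apply: conn_refl; rewrite /= Aw; lia.
    move: lohi; rewrite leq_eqVlt => /orP[/eqP lohi|lthi].
      by left; exists w, w; split=> //; lia.
    by right; right; split; [lia|exists w].
  move: v uv {hiv}; apply: conn_ind.
    move: ulo; rewrite leq_eqVlt => /orP[/eqP ulo|]; last by right; left.
    exact: start.
  move=> v w uv [H|H] vw Aw; first by left.
  have wv := f_king vw.
  have [wlo|[wlo|wlo]] : f w < lo \/ f w = lo \/ lo < f w by lia.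
  - by right; left.
  - exact: start.
  case: H => [|[vhi [u' u'lo u'v]]]; first by lia.
  have u'w : conn B u' w by apply: conn_rcons u'v vw _; rewrite /= Aw; lia.
  have [whi|whi] : f w < hi \/ f w = hi by lia.
    by right; right; split=> //; exists u'.
  by left; exists u', w.
case=> // -[|[]]; lia.
Qed.

End Subcrossing.

(* Planarity is a parity argument: along a path [A] that never touches the path
   [B], the number of steps of [B] that leave the column of the current cell of
   [A] to the right, starting above that cell, has constant parity. *)
Let step_right c y v w := ((v.1 == c) && (w.1 == c.+1) && (y < v.2)) ||
  ((w.1 == c) && (v.1 == c.+1) && (y < w.2)).
Let step_left c y v w := ((v.1 == c) && (w.1.+1 == c) && (y < v.2)) ||
  ((w.1 == c) && (v.1.+1 == c) && (y < w.2)).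

Fixpoint parity (r : rel (nat * nat)) v (q : seq (nat * nat)) :=
  if q is w :: q' then r v w (+) parity r w q' else false.

Let parity_rcons r v q w : parity r v (rcons q w) = parity r v q (+) r (last v q) w.
Proof. by elim: q v => [|z q IH] v /=; rewrite ?addbF // IH addbA. Qed.

Let eq_parity (P : pred (nat * nat)) r r' v q :
  (forall z w, P z -> P w -> king z w -> r z w = r' z w) ->
  path king v q -> all P (v :: q) -> parity r v q = parity r' v q.
Proof.
move=> rr'; elim: q v => [//|w q IH] v /= /andP[vw pq] /and3P[Pv Pw Pq].
by rewrite rr' // IH //= Pw Pq.
Qed.

(** The path keeps away from [(c, y)], so the counted steps are exactly those that enter or leave
    the part of column [c] above [y]. As both ends lie outside the column, their total number is
    even. *)
Let parity_left_right c y v q : path king v q ->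
  all (fun w => ~~ king (c, y) w) (v :: q) -> v.1 != c -> (last v q).1 != c ->
  parity (step_left c y) v q = parity (step_right c y) v q.
Proof.
move=> pq aq vc lc.
pose above (w : nat * nat) := (w.1 == c) && (y < w.2).
suff E w : path king w q -> all (fun z => ~~ king (c, y) z) (w :: q) ->
    parity (step_left c y) w q (+) parity (step_right c y) w q =
    above w (+) above (last w q).
  have := E v pq aq; rewrite /above (negbTE vc) (negbTE lc) /=.
  by case: (parity (step_left c y) v q); case: (parity (step_right c y) v q).
elim: q w {pq aq lc} => [|z q IH] w /=; first by rewrite addbb.
move=> /andP[wz pq] /and3P[nw nz aq].
have -> : above w (+) above (last z q) =
  (above w (+) above z) (+) (above z (+) above (last z q)).
  by rewrite -addbA addKb.
have E : step_left c y w z (+) step_right c y w z = above w (+) above z.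
  move: wz nw nz; rewrite /king /step_left /step_right /above /=.
  case: w z {IH pq aq} => [wx wy] [zx zy] /=.
  have [->|wc] := eqVneq wx c; have [->|zc] := eqVneq zx c; lia.
rewrite -IH /= ?nz // -E.
by case: (step_left c y w z); case: (step_right c y w z);
  case: (parity (step_left c y) z q); case: (parity (step_right c y) z q).
Qed.

Let same_column c y z v w : y <= z.+1 -> z <= y.+1 ->
  ~~ king (c, y) v -> ~~ king (c, z) v -> ~~ king (c, y) w -> ~~ king (c, z) w ->
  step_right c z v w = step_right c y v w.
Proof.
rewrite /king /step_right /=; case: v w => [vx vy] [wx wy] /=.
by have [->|vc] := eqVneq vx c; have [->|wc] := eqVneq wx c; lia.
Qed.

(** A step between the two columns is seen from either of them. The two height tests agree because
    neither end of the step is close to [(c, y)] or [(c.+1, z)]. *)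
Let next_column c y z v w : y <= z.+1 -> z <= y.+1 ->
  ~~ king (c, y) v -> ~~ king (c.+1, z) v ->
  ~~ king (c, y) w -> ~~ king (c.+1, z) w -> king v w ->
  step_left c.+1 z v w = step_right c y v w.
Proof.
rewrite /king /step_right /step_left /=; case: v w => [vx vy] [wx wy] /=.
have [->|vc] := eqVneq vx c; have [->|wc] := eqVneq wx c.
- lia.
- have [->|wc1] := eqVneq wx c.+1; lia.
- have [->|vc1] := eqVneq vx c.+1; lia.
- lia.
Qed.

Lemma crossing_paths_touch A B L u u' d d' :
  (forall w, A w -> w.1 <= L) -> (forall w, B w -> w.1 <= L) ->
  conn A u u' -> conn B d d' ->
  u.1 = 0 -> u'.1 = L -> d.1 = 0 -> d'.1 = L -> u.2 < d.2 -> d'.2 < u'.2 ->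
  exists a b, [/\ conn A u a, conn B d b & king a b].
Proof.
move=> AL BL uu' [q [pq Bq lq]] u0 u'L d0 d'L ud d'u'.
have [[a [b [ua db ab]]]|N] := EM (exists a b, [/\ conn A u a, conn B d b & king a b]).
  by exists a, b.
exfalso.
(* Everything is shifted by one column and [B] is prolonged by one cell at each end, so that its
   ends lie in columns which [A] never visits, as [parity_left_right] requires. *)
pose sh (w : nat * nat) := (w.1.+1, w.2).
pose q' := rcons (map sh (d :: q)) (L.+2, d'.2).
pose d0' := (0, d.2).
have pq' : path king d0' q'.
  rewrite /q' rcons_path /= last_map lq path_map; apply/andP; split; last first.
    by rewrite /sh /king /=; lia.
  apply/andP; split; first by rewrite /d0' /sh /king /=; lia.
  by apply: sub_path pq => v w; rewrite /king /=; lia.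
have dq b : b \in d :: q -> conn B d b by exact: conn_path_mem.
have far v : conn A u v -> all (fun w => ~~ king (sh v) w) (d0' :: q').
  move=> uv; have dN b : b \in d :: q -> ~~ king v b.
    by move=> /dq db; apply/negP => vb; apply: N; exists v, b.
  have shN b : b \in d :: q -> ~~ king (sh v) (sh b) by move=> /dN.
  rewrite /= all_rcons /= all_map; apply/and4P; split.
  - by move: (dN d (mem_head _ _)); rewrite /king /=; lia.
  - exact/shN/mem_head.
  - have : d' \in d :: q by rewrite -lq mem_last.
    by move=> /dN; have [_ /AL] := conn_in uv; rewrite /king /=; lia.
  - by apply/allP => b bq /=; apply: shN; rewrite inE bq orbT.
pose T v := parity (step_right (sh v).1 (sh v).2) d0' q'.
have TL v : conn A u v ->
  parity (step_left (sh v).1 (sh v).2) d0' q' = T v.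
  move=> uv; apply: parity_left_right => //; first exact: far.
  rewrite /q' last_rcons /=; have [_ /AL] := conn_in uv; lia.
have parity0 v p : parity (fun _ _ => false) v p = false by elim: p v => //=.
(* Only the added first step reaches column 0, and it is counted because [d] is above [u]. *)
have T0 : T u.
  have [Au _] := conn_in uu'.
  rewrite -TL; last exact: conn_refl.
  have pq1 : path king (sh d) (rcons (map sh q) (L.+2, d'.2)).
    by move: pq' => /= /andP[].
  rewrite /q' /= (eq_parity (P := fun w => 0 < w.1) (r' := fun _ _ => false) _ pq1).
  - by rewrite parity0 /step_left /sh /d0' /= u0 d0 ud.
  - by move=> a b; rewrite /step_left /sh /=; lia.
  - by rewrite /= all_rcons /= all_map; apply/allP.
(* Only the added last step leaves the last column to the right, and it is not counted because [d']
   is below [u']. *)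
have T1 : T u' = false.
  have pq1 : path king d0' (map sh (d :: q)).
    by move: pq'; rewrite rcons_path => /andP[].
  rewrite /T /q' parity_rcons /= last_map lq.
  rewrite -[_ (+) parity _ (sh d) _]/(parity _ d0' (map sh (d :: q))).
  rewrite (eq_parity (P := fun w => w.1 <= L.+1) (r' := fun _ _ => false) _ pq1).
  - by rewrite parity0 /step_right /sh /=; lia.
  - by move=> a b; rewrite /step_right /sh /=; lia.
  - by apply/allP => b; rewrite inE => /predU1P[->//|/mapP[z /(allP Bq) /BL zL ->]].
suff : T u' by rewrite T1.
move: u' uu' {u'L d'u' T1}; apply: conn_ind => // v w uv Tv vw Aw.
have uw : conn A u w := conn_rcons uv vw Aw.
have {}far : all (fun z => ~~ king (sh v) z && ~~ king (sh w) z) (d0' :: q').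
  by rewrite all_predI !far.
suff -> : T w = T v by [].
have vw2 : v.2 <= w.2.+1 /\ w.2 <= v.2.+1 by move: vw; rewrite /king; lia.
have [vw1|[vw1|vw1]] : w.1 = v.1 \/ w.1 = v.1.+1 \/ v.1 = w.1.+1.
  by move: vw; rewrite /king; lia.
- apply: (eq_parity _ pq' far) => a b /andP[va wa] /andP[vb wb] _.
  by move: va wa vb wb; rewrite /sh /= vw1; apply: same_column; lia.
- rewrite -TL //; apply: (eq_parity _ pq' far) => a b /andP[va wa] /andP[vb wb].
  by move: va wa vb wb; rewrite /sh /= vw1; apply: next_column; lia.
- rewrite -(TL _ uv); apply/esym/(eq_parity _ pq' far) => a b /andP[va wa] /andP[vb wb].
  by move: wa va wb vb; rewrite /sh /= vw1; apply: next_column; lia.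
Qed.

End KingPaths.

(** * Faces of the cell complexes *)

Section Coarsening.
Implicit Types (d x y u : nat).

(* A face of the level-k subdivision of the line is coded by a number [x]: the
   open interval (a, a + 1) by 2a and the point a + 1 by 2a + 1.  Then [x./2] and
   [uphalf x] are the level-k intervals whose closures contain the face, and
   [coarse d x] is the face containing it in the subdivision coarser by [d].
   The end points of the unit interval have no code: a crossing can be pushed
   inside. *)
Definition coarse d x := x./2 %/ d + uphalf x %/ d.

(** The two quotients differ by at most one, so they can be recovered as the two halves of their
    sum. *)
Lemma half_uphalf_coarse d x : 0 < d ->
  (coarse d x)./2 = x./2 %/ d /\ uphalf (coarse d x) = uphalf x %/ d.
Proof.
move=> d0; have l1 : x./2 %/ d <= uphalf x %/ d by apply: leq_div2r; lia.
have l2 : uphalf x %/ d <= (x./2 %/ d).+1.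
  have : uphalf x <= x./2 + d by lia.
  by move/(leq_div2r d); rewrite divnDr ?dvdnn // divnn d0 addn1.
rewrite /coarse; lia.
Qed.

Lemma half_coarse d x : 0 < d -> (coarse d x)./2 = x./2 %/ d.
Proof. by case/(half_uphalf_coarse x). Qed.

Lemma uphalf_coarse d x : 0 < d -> uphalf (coarse d x) = uphalf x %/ d.
Proof. by case/(half_uphalf_coarse x). Qed.

Lemma coarseM d e x : 0 < d -> coarse e (coarse d x) = coarse (d * e) x.
Proof.
by move=> d0; rewrite {1}/coarse half_coarse // uphalf_coarse // -!divnMA.
Qed.

Lemma coarse1 x : coarse 1 x = x.
Proof. by rewrite /coarse !divn1; lia. Qed.

Lemma coarse0 d : coarse d 0 = 0.
Proof. by rewrite /coarse !div0n. Qed.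

Lemma leq_coarse d x y : x <= y -> coarse d x <= coarse d y.
Proof. by move=> xy; apply: leq_add; apply: leq_div2r; lia. Qed.

Lemma coarseS d x : 0 < d -> coarse d x.+1 <= (coarse d x).+1.
Proof.
move=> d0; rewrite /coarse.
have -> : x.+1./2 = uphalf x by [].
have -> : uphalf x.+1 = x./2.+1 by [].
have S y : y.+1 %/ d <= (y %/ d).+1.
  have : y.+1 <= y + d by lia.
  by move/(leq_div2r d); rewrite divnDr ?dvdnn // divnn d0 addn1.
have [E|E] : (x./2 = uphalf x) \/ (uphalf x = x./2.+1) by lia.
  by rewrite E; have := S (uphalf x); lia.
by rewrite E; have := S x./2; lia.
Qed.

Lemma coarse_add d x a : 0 < d -> coarse d (x + 2 * (a * d)) = coarse d x + 2 * a.
Proof.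
move=> d0; rewrite /coarse.
have -> : (x + 2 * (a * d))./2 = a * d + x./2 by lia.
have -> : uphalf (x + 2 * (a * d)) = a * d + uphalf x by lia.
by rewrite !divnMDl //; lia.
Qed.

Lemma half_le_uphalf x : x./2 <= uphalf x.
Proof. lia. Qed.

Lemma uphalf_ltn x a : (uphalf x < a) = (x.+1 < 2 * a).
Proof. lia. Qed.

Lemma coarse_ltn d x a : 0 < d -> ((coarse d x).+1 < 2 * a) = (x.+1 < 2 * (a * d)).
Proof. by move=> d0; rewrite -!uphalf_ltn uphalf_coarse // ltn_divLR. Qed.

Lemma leq_coarse_double d x a : 0 < d -> (2 * a <= coarse d x) = (2 * (a * d) <= x).
Proof.
move=> d0; have E y b : (2 * b <= y) = (b <= y./2) by lia.
by rewrite !E half_coarse // leq_divRL.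
Qed.

Lemma coarse_last d a : 0 < d -> 0 < a -> coarse d (2 * (a * d) - 2) = 2 * a - 2.
Proof.
case: a => // a d0 _; apply/eqP; rewrite eqn_leq.
have := leq_coarse_double (2 * (a.+1 * d) - 2) a d0.
have := coarse_ltn (2 * (a.+1 * d) - 2) a.+1 d0; rewrite !mulSn.
lia.
Qed.

Lemma king_coarse d e v w : 0 < d -> 0 < e -> king v w ->
  king (coarse d v.1, coarse e v.2) (coarse d w.1, coarse e w.2).
Proof.
have E c x y : 0 < c -> x <= y.+1 -> coarse c x <= (coarse c y).+1.
  by move=> c0 /(leq_coarse c) /leq_trans; apply; apply: coarseS.
by move=> d0 e0; rewrite /king /= => /and4P[*]; rewrite !E.
Qed.

End Coarsening.

(** * Open faces and horizontal crossings of boxes *)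

Section Faces.
Variables (n m : nat).
Hypotheses (n_gt0 : 0 < n) (m_gt0 : 0 < m).
Let nk k : 0 < n ^ k. Proof. by rewrite expn_gt0 n_gt0. Qed.
Let mk k : 0 < m ^ k. Proof. by rewrite expn_gt0 m_gt0. Qed.

Implicit Types (s t : nat * nat * nat -> bool) (v w : nat * nat).

(** The four triples name the closed level-[l] rectangles that contain the face; they are all the
    same for a two-dimensional face. *)
Definition face_selected s l x y :=
  [|| s (l, x./2, y./2), s (l, x./2, uphalf y),
      s (l, uphalf x, y./2) | s (l, uphalf x, uphalf y)].

Definition face_open k s : pred (nat * nat) := fun v =>
  all (fun l => face_selected s l (coarse (n ^ (k - l)) v.1)
                                  (coarse (m ^ (k - l)) v.2)) (iota 1 k).

Lemma face_openP k s v : reflect (forall l, 0 < l <= k ->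
    face_selected s l (coarse (n ^ (k - l)) v.1) (coarse (m ^ (k - l)) v.2))
  (face_open k s v).
Proof.
apply: (iffP allP) => H l lk; apply: H; move: lk; rewrite mem_iota; lia.
Qed.

Lemma face_selected_le s t l x y : (forall i, s i -> t i) ->
  face_selected s l x y -> face_selected t l x y.
Proof.
by move=> st; rewrite /face_selected => /or4P[]/st->; rewrite ?orbT.
Qed.

Lemma face_open_le k s t v : (forall i, s i -> t i) ->
  face_open k s v -> face_open k t v.
Proof.
move=> st /face_openP sv; apply/face_openP => l /sv.
exact: face_selected_le.
Qed.

Definition shift_level j (i : nat * nat * nat) := (j + i.1.1, i.1.2, i.2).

Lemma face_open_shift j k s v : face_open (j + k) s v ->
  face_open k (s \o shift_level j) v.
Proof.
move=> /face_openP sv; apply/face_openP => l lk.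
have := sv (j + l); rewrite subnDl; apply; lia.
Qed.

Lemma face_open_coarse j k s v : face_open (k + j) s v ->
  face_open k s (coarse (n ^ j) v.1, coarse (m ^ j) v.2).
Proof.
move=> /face_openP sv; apply/face_openP => l lk /=.
rewrite !coarseM // -!expnD; have -> : j + (k - l) = k + j - l by lia.
by apply: sv; lia.
Qed.

(** A move by [a] unit squares to the right and [b] upwards. The discrete model lives on the whole
    quadrant, tiled by copies of the unit square. *)
Definition translate a b (i : nat * nat * nat) :=
  (i.1.1, i.1.2 + a * n ^ i.1.1, i.2 + b * m ^ i.1.1).

Lemma half_addM x a : (x + 2 * a)./2 = x./2 + a. Proof. lia. Qed.
Lemma uphalf_addM x a : uphalf (x + 2 * a) = uphalf x + a. Proof. lia. Qed.

Lemma king_fst v w : king v w -> w.1 <= v.1.+1.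
Proof. by case/and4P. Qed.

Lemma king_snd v w : king v w -> w.2 <= v.2.+1.
Proof. by case/and4P. Qed.

Lemma face_open_translate a b k s v : face_open k (s \o translate a b) v =
  face_open k s (v.1 + 2 * (a * n ^ k), v.2 + 2 * (b * m ^ k)).
Proof.
apply: eq_in_all => l; rewrite mem_iota => lk /=.
have E c : c ^ k = c ^ l * c ^ (k - l) by rewrite -expnD subnKC //; lia.
rewrite !E (mulnA a) (mulnA b) !coarse_add //.
by rewrite /face_selected /translate /= !half_addM !uphalf_addM.
Qed.

(** The mirror image of the first [u] unit columns; the columns beyond are fixed, which keeps the
    map injective. *)
Definition reflect_columns u (i : nat * nat * nat) :=
  (i.1.1, if i.1.2 < u * n ^ i.1.1 then (u * n ^ i.1.1).-1 - i.1.2 else i.1.2, i.2).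

Lemma divn_reverse d c a : 0 < d -> a < c * d ->
  ((c * d).-1 - a) %/ d = c.-1 - a %/ d.
Proof.
move=> d0 acd; have qc : a %/ d < c by rewrite ltn_divLR.
have rd : a %% d < d by rewrite ltn_mod.
have -> : (c * d).-1 - a = (c.-1 - a %/ d) * d + (d.-1 - a %% d).
  have E := divn_eq a d; case: c acd qc => // c acd; rewrite ltnS => qc.
  rewrite mulSn in acd *; rewrite /= mulnBl.
  have : a %/ d * d <= c * d by rewrite leq_mul2r qc orbT.
  by move: (a %/ d * d) E => q E; lia.
by rewrite divnMDl // (@divn_small (d.-1 - a %% d)) ?addn0 //; lia.
Qed.

Lemma face_open_reflect u k s v : v.1.+1 < 2 * (u * n ^ k) ->
  face_open k (s \o reflect_columns u) v =
  face_open k s (2 * (u * n ^ k) - 2 - v.1, v.2).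
Proof.
move=> vu; apply: eq_in_all => l; rewrite mem_iota => lk /=.
have E : u * n ^ k = u * n ^ l * n ^ (k - l).
  by rewrite -mulnA -expnD subnKC //; lia.
have hu : uphalf v.1 < u * n ^ k by rewrite uphalf_ltn.
have hl : v.1./2 < u * n ^ k by lia.
set x := 2 * _ - 2 - _.
(* The mirror exchanges the left and the right neighbour of a face. *)
have E1 : x./2 = (u * n ^ k).-1 - uphalf v.1 by rewrite /x; lia.
have E2 : uphalf x = (u * n ^ k).-1 - v.1./2 by rewrite /x; lia.
rewrite /face_selected !half_coarse // !uphalf_coarse // E1 E2.
rewrite E in hu hl *; rewrite !divn_reverse // /reflect_columns /=.
rewrite !ltn_divLR // hu hl.
by rewrite orbA orbC -orbA.
Qed.

Implicit Types (P Q : pred nat).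

(** All rectangles around the face must lie in the box of [W] by [h] unit squares. Thus the codes in
    a direction with N intervals run from 0 to 2N - 2. *)
Definition open_in_box k W h s : pred (nat * nat) := fun v =>
  [&& face_open k s v, v.1.+1 < 2 * (W * n ^ k) & v.2.+1 < 2 * (h * m ^ k)].

(** [P] and [Q] constrain the level-0 row faces in which the crossing starts and ends; sloped
    crossings are expressed through them. *)
Definition h_cross k W h P Q : set (nat * nat * nat -> bool) := [set s |
  exists v w, [/\ v.1 = 0, w.1 = 2 * (W * n ^ k) - 2, P (coarse (m ^ k) v.2),
    Q (coarse (m ^ k) w.2) & conn (open_in_box k W h s) v w]].

Lemma h_cross_isotone k W h P Q s t : (forall i, s i -> t i) ->
  h_cross k W h P Q s -> h_cross k W h P Q t.
Proof.
move=> st [v [w [v1 w1 Pv Qw vw]]]; exists v, w; split=> //.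
apply: conn_sub vw => z /and3P[zo z1 z2]; apply/and3P; split=> //.
exact: face_open_le zo.
Qed.

Lemma h_cross_depends k W h P Q s t :
  (forall l a b, 0 < l <= k -> a < W * n ^ l -> b < h * m ^ l -> s (l, a, b) = t (l, a, b)) ->
  h_cross k W h P Q s -> h_cross k W h P Q t.
Proof.
move=> st [v [w [v1 w1 Pv Qw vw]]]; exists v, w; split=> //.
apply: conn_sub vw => z /and3P[/face_openP zo z1 z2]; apply/and3P; split=> //.
apply/face_openP => l lk; have := zo l lk; rewrite /face_selected.
have E c : c ^ k = c ^ l * c ^ (k - l) by rewrite -expnD subnKC //; lia.
move: z1 z2; rewrite !E (mulnA W) (mulnA h).
rewrite -(@coarse_ltn (n ^ (k - l))) // -(@coarse_ltn (m ^ (k - l))) //.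
rewrite -!uphalf_ltn => z1 z2.
have z1' := leq_ltn_trans (half_le_uphalf _) z1.
have z2' := leq_ltn_trans (half_le_uphalf _) z2.
by rewrite !st.
Qed.

Lemma conn_coarse k W h s v w : conn (open_in_box k.+1 W h s) v w ->
  conn (open_in_box k W h s) (coarse (n ^ 1) v.1, coarse (m ^ 1) v.2)
    (coarse (n ^ 1) w.1, coarse (m ^ 1) w.2).
Proof.
pose f (z : nat * nat) := (coarse (n ^ 1) z.1, coarse (m ^ 1) z.2).
apply: (conn_map (f := f)) => [z /and3P[zo z1 z2]|z z' _ _]; last exact: king_coarse.
apply/and3P; split=> /=.
- by apply: face_open_coarse; rewrite // addn1.
- by rewrite coarse_ltn // -mulnA -expnSr.
- by rewrite coarse_ltn // -mulnA -expnSr.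
Qed.

Lemma coarse_last_expn W k :
  coarse (n ^ 1) (2 * (W * n ^ k.+1) - 2) = 2 * (W * n ^ k) - 2.
Proof.
rewrite expn1 expnSr (mulnA W).
case: W => [|W]; first by rewrite !mul0n coarse0.
by rewrite coarse_last // muln_gt0 nk.
Qed.

(** Coarsening respects king moves, openness and the two end columns, so it carries a fine crossing
    to a coarse one. *)
Lemma h_cross_antitone k W h P Q s :
  h_cross k.+1 W h P Q s -> h_cross k W h P Q s.
Proof.
move=> [v [w [v1 w1 Pv Qw vw]]]; have := conn_coarse vw.
set v' := (_, _); set w' := (_, _) => vw'; exists v', w'; split=> //.
- by rewrite /= v1 coarse0.
- by rewrite /= w1 coarse_last_expn.
- by rewrite /= coarseM // -expnD add1n.
- by rewrite /= coarseM // -expnD add1n.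
Qed.

(** Once the first [j] levels are forgotten, the level-[j] rectangles play the part of unit
    squares. *)
Lemma h_cross_shift j k W h P Q s : h_cross (j + k) W h P Q s ->
  h_cross k (W * n ^ j) (h * m ^ j) predT predT (s \o shift_level j).
Proof.
move=> [v [w [v1 w1 _ _ vw]]]; exists v, w; split=> //.
  by rewrite w1 expnD (mulnA W).
apply: conn_sub vw => z /and3P[zo z1 z2]; apply/and3P; split=> //.
- exact: face_open_shift.
- by rewrite -mulnA -expnD.
- by rewrite -mulnA -expnD.
Qed.

Lemma h_cross_W k W h h' P P' Q Q' s : h <= h' ->
  (forall x, P x -> P' x) -> (forall x, Q x -> Q' x) ->
  h_cross k W h P Q s -> h_cross k W h' P' Q' s.
Proof.
move=> hh PP QQ [v [w [v1 w1 Pv Qw vw]]]; exists v, w; split; auto.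
apply: conn_sub vw => z /and3P[zo z1 z2]; apply/and3P; split=> //.
by apply: leq_trans z2 _; rewrite leq_mul2l leq_mul2r hh orbT.
Qed.

Lemma h_cross_reflect k W h P Q s :
  h_cross k W h P Q (s \o reflect_columns W) -> h_cross k W h Q P s.
Proof.
move=> [v [w [v1 w1 Pv Qw vw]]].
pose f z : nat * nat := (2 * (W * n ^ k) - 2 - z.1, z.2).
have fvw : conn (open_in_box k W h s) (f v) (f w).
  apply: (conn_map (f := f) _ _ vw) => [z /and3P[zo z1 z2]|z z' /and3P[_ z1 _] /and3P[_ z2 _]].
    move: zo; rewrite face_open_reflect // => zo.
    by apply/and3P; split=> //=; lia.
  by rewrite /king /f /=; lia.
exists (f w), (f v); split=> //=.
- by rewrite w1 subnn.
- by rewrite v1 subn0.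
- exact: conn_sym.
Qed.

Lemma h_cross_column k W h i s : i < W ->
  h_cross k W h predT predT s ->
  h_cross k 1 h predT predT (s \o translate i 0).
Proof.
move=> iW [v [w [v1 w1 _ _ vw]]].
have WN : (i.+1 * n ^ k) <= W * n ^ k by rewrite leq_mul2r iW orbT.
have iN : i.+1 * n ^ k = i * n ^ k + n ^ k by rewrite mulSn addnC.
have n0 := nk k.
have [|||v' [w' [v'1 w'1 vw']]] := conn_crossing king_fst vw
  (lo := 2 * (i * n ^ k)) (hi := 2 * (i.+1 * n ^ k) - 2).
- by lia.
- by rewrite v1.
- by rewrite w1; lia.
pose f z : nat * nat := (z.1 - 2 * (i * n ^ k), z.2).
exists (f v'), (f w'); split=> //=; rewrite ?v'1 ?w'1 ?subnn ?iN ?mul1n //; first lia.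
apply: (conn_map (f := f) _ _ vw') => [z /andP[/and3P[zo z1 z2] /andP[z3 z4]]|z z' _ _].
  apply/and3P; split=> //=; last lia.
  rewrite face_open_translate //= !mul0n muln0 addn0 subnK //.
by rewrite /king /=; lia.
Qed.



Lemma conn_translate_rows k W h r s v w : 0 < h ->
  conn [pred z | [&& face_open k s z, z.1.+1 < 2 * (W * n ^ k),
    2 * (r * m ^ k) <= z.2 & z.2.+1 < 2 * ((r + h) * m ^ k)]] v w ->
  conn (open_in_box k W h (s \o translate 0 r))
    (v.1, v.2 - 2 * (r * m ^ k)) (w.1, w.2 - 2 * (r * m ^ k)).
Proof.
move=> h0; pose f z : nat * nat := (z.1, z.2 - 2 * (r * m ^ k)).
have m0 := mk k.
apply: (conn_map (f := f)) => [z /and4P[zo z1 z2 z3]|z z' _ _].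
  apply/and3P; split=> //=; last by move: z3; rewrite mulnDl; lia.
  by rewrite face_open_translate //= !mul0n muln0 addn0 subnK.
by rewrite /king /=; lia.
Qed.

(** When all rectangles up to level [j] are selected, these levels impose nothing, and the deeper
    ones are those of the shifted model. *)
Lemma h_cross_join j k h s : h <= m ^ j ->
  (forall l a b, 0 < l <= j -> a < n ^ l -> b < m ^ l -> s (l, a, b)) ->
  h_cross k (n ^ j) h predT predT (s \o shift_level j) ->
  h_cross (j + k) 1 1 predT predT s.
Proof.
move=> hj full [v [w [v1 w1 _ _ vw]]]; exists v, w; split=> //.
  by rewrite w1 mul1n expnD.
apply: conn_sub vw => z /and3P[/face_openP zo z1 z2].
have {}z2 : z.2.+1 < 2 * (m ^ j * m ^ k).
  by apply: leq_trans z2 _; rewrite leq_mul2l leq_mul2r hj orbT.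
apply/and3P; split; rewrite ?mul1n ?expnD //; apply/face_openP => l lk.
have [lj|jl] := leqP l j; last first.
  have := zo (l - j); rewrite /face_selected /shift_level /= subnKC; last lia.
  have -> : k - (l - j) = j + k - l by lia.
  by apply; lia.
apply/orP; left; have l0 : 0 < l by lia.
have E c : c ^ j * c ^ k = c ^ l * c ^ (j + k - l).
  by rewrite -!expnD subnKC //; lia.
apply: full; first lia.
  apply: leq_ltn_trans (half_le_uphalf _) _.
  by rewrite uphalf_ltn coarse_ltn // -E.
apply: leq_ltn_trans (half_le_uphalf _) _.
by rewrite uphalf_ltn coarse_ltn // -E.
Qed.

(** The crossing starts in the level-[K] row face [a] and is stopped at its first arrival at the far
    end of column [x]. If all stopped paths end within two codes of [a], each column has a selected
    rectangle in the same four rows; otherwise one of these paths is a sloped crossing of the first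
    [x + 1] columns. *)
Lemma h_cross_slopes K k W h s : 0 < K ->
  h_cross (K + k) W h predT predT s ->
  (exists2 c, c < h * m ^ K & forall x, x < W * n ^ K ->
     has (fun b => s (K, x, b)) (iota c 4)) \/
  exists u a b, [/\ u <= W * n ^ K, a < 2 * (h * m ^ K), b < 2 * (h * m ^ K),
    (a + 3 <= b) || (b + 3 <= a) &
    h_cross k u (h * m ^ K) (pred1 a) (pred1 b) (s \o shift_level K)].
Proof.
move=> K0 [v [w [v1 w1 _ _ vw]]].
pose A := open_in_box (K + k) W h s.
have zH z : A z -> (coarse (m ^ k) z.2).+1 < 2 * (h * m ^ K).
  by case/and3P=> _ _; rewrite expnD (mulnA h) -coarse_ltn.
have [Av Aw] := conn_in vw; have av := zH _ Av.
set a := coarse (m ^ k) v.2 in av.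
have [|H] := pselect (exists u a b, [/\ u <= W * n ^ K, a < 2 * (h * m ^ K),
    b < 2 * (h * m ^ K), (a + 3 <= b) || (b + 3 <= a) &
    h_cross k u (h * m ^ K) (pred1 a) (pred1 b) (s \o shift_level K)]).
  by right.
(* A code at distance at most 2 from [a] has both halves between [a./2 - 1] and [a./2 + 2], which
   are four rows. *)
left; exists (a./2.-1) => [|x xW]; first by lia.
have n0 := nk k; have xn : x.+1 * n ^ k <= W * n ^ K * n ^ k.
  by rewrite leq_mul2r xW orbT.
have [|v' v'1 vv'] := conn_first_hit king_fst vw (hi := 2 * (x.+1 * n ^ k) - 2).
  by rewrite v1 w1 expnD (mulnA W) /=; lia.
have [_ /andP[Av' _]] := conn_in vv'; have bv := zH _ Av'.
set b := coarse (m ^ k) v'.2 in bv.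
have {H} : (b < a + 3) && (a < b + 3).
  apply/negPn/negP => ab; apply: H; exists x.+1, a, b; split=> //; try lia.
  exists v, v'; split=> //=.
  apply: conn_sub vv' => z /andP[/and3P[zo z1 z2] z3]; apply/and3P; split.
  - exact: face_open_shift.
  - by move: z3 => /=; rewrite mulSn; lia.
  - by move: z2; rewrite expnD (mulnA h).
move=> /andP[ba ab].
case/and3P: Av' => /face_openP/(_ K) vo _ _.
have {vo} : face_selected s K (coarse (n ^ k) v'.1) b.
  by have := vo; rewrite addKn; apply; lia.
rewrite v'1 coarse_last // /face_selected.
have -> : (2 * x.+1 - 2)./2 = x by lia.
have -> : uphalf (2 * x.+1 - 2) = x by lia.
have b1 : b./2 \in iota (a./2.-1) 4 by rewrite mem_iota; lia.
have b2 : uphalf b \in iota (a./2.-1) 4 by rewrite mem_iota; lia.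
by case/or4P => sx; apply/hasP; [exists b./2|exists (uphalf b)|exists b./2|exists (uphalf b)].
Qed.

End Faces.

(** * Vertical crossings and planar gluing *)

Definition transpose (i : nat * nat * nat) := (i.1.1, i.2, i.1.2).

Lemma face_open_transpose n m k s v :
  face_open n m k (s \o transpose) v = face_open m n k s (v.2, v.1).
Proof.
apply: eq_in_all => l _; rewrite /face_selected /transpose /=.
by congr orb; rewrite orbCA.
Qed.

(** Vertical crossings are horizontal crossings of the transposed model, with [n] and [m] exchanged,
    so results on the latter serve both directions. *)
Definition v_cross n m k W h : set (nat * nat * nat -> bool) :=
  [set s : nat * nat * nat -> bool | h_cross m n k h W predT predT (s \o transpose)].

Section VerticalCrossings.
Variables (n m : nat).
Hypotheses (n_gt0 : 0 < n) (m_gt0 : 0 < m).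
Let nk k : 0 < n ^ k. Proof. by rewrite expn_gt0 n_gt0. Qed.
Let mk k : 0 < m ^ k. Proof. by rewrite expn_gt0 m_gt0. Qed.
Implicit Types (s : nat * nat * nat -> bool) (v w : nat * nat).

Lemma v_crossP k W h s : v_cross n m k W h s <->
  exists v w, [/\ v.2 = 0, w.2 = 2 * (h * m ^ k) - 2 &
    conn (open_in_box n m k W h s) v w].
Proof.
pose f (z : nat * nat) := (z.2, z.1).
have fk v w : king v w -> king (f v) (f w) by rewrite /king /=; lia.
split=> [[v [w [v1 w1 _ _ vw]]]|[v [w [v1 w1 vw]]]].
  exists (f v), (f w); split=> //=; apply: (conn_map (f := f) _ _ vw) => [z|z z' _ _].
    by rewrite /open_in_box face_open_transpose /=; case/and3P=> -> -> ->.
  exact: fk.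
exists (f v), (f w); split=> //=; apply: (conn_map (f := f) _ _ vw) => [z|z z' _ _].
  rewrite /open_in_box face_open_transpose /=.
  by rewrite -surjective_pairing; case/and3P=> -> -> ->.
exact: fk.
Qed.

Lemma v_cross_rows k W h r s v w : 0 < h ->
  conn [pred z | face_open n m k s z && (z.1.+1 < 2 * (W * n ^ k))] v w ->
  coarse (m ^ k) v.2 < 2 * r -> 2 * (r + h) <= (coarse (m ^ k) w.2).+1 ->
  v_cross n m k W h (s \o translate n m 0 r).
Proof.
move=> h0 vw vr wr; have m0 := mk k.
have l1 : v.2 <= 2 * (r * m ^ k).
  by apply/ltnW; rewrite ltnNge -leq_coarse_double // -ltnNge.
have l2 : 2 * ((r + h) * m ^ k) <= w.2.+1.
  by rewrite leqNgt -coarse_ltn // -leqNgt.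
have hm : 0 < h * m ^ k by rewrite muln_gt0 h0.
have [|||v' [w' [v'1 w'1 vw']]] := conn_crossing king_snd vw
  (lo := 2 * (r * m ^ k)) (hi := 2 * ((r + h) * m ^ k) - 2).
- by rewrite mulnDl; lia.
- by [].
- by lia.
apply/v_crossP; exists (v'.1, v'.2 - 2 * (r * m ^ k)), (w'.1, w'.2 - 2 * (r * m ^ k)).
split; [by rewrite /= v'1 subnn|by rewrite /= w'1 mulnDl; lia|].
apply: conn_translate_rows => //.
apply: conn_sub vw' => z /andP[/andP[zo z1] /andP[z2 z3]] /=.
by rewrite zo z1 z2 /=; move: z3; rewrite mulnDl; lia.
Qed.

(** Let [c] be the lowest row face that the cluster of the crossing meets. Either the cluster stays
    in the rows [c./2] and [c./2 + 1], or it climbs over the row [c./2 + 1] and crosses that cell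
    vertically. *)
Lemma h_cross_two_rows k N s : h_cross n m k 1 N predT predT s ->
  exists2 r, r < N & h_cross n m k 1 2 predT predT (s \o translate n m 0 r) \/
    v_cross n m k 1 1 (s \o translate n m 0 r.+1).
Proof.
move=> [v [w [v1 w1 _ _ vw]]]; set A := open_in_box n m k 1 N s in vw.
have [Av _] := conn_in vw.
pose P c := `[< exists2 z, conn A v z & coarse (m ^ k) z.2 = c >].
have exP : exists c, P c.
  by exists (coarse (m ^ k) v.2); apply/asboolP; exists v => //; apply: conn_refl.
case: (ex_minnP exP) => c /asboolP[z vz zc] cmin.
have {}cmin z' : conn A v z' -> c <= coarse (m ^ k) z'.2.
  by move=> vz'; apply: cmin; apply/asboolP; exists z'.
exists c./2.
  have := cmin v (conn_refl Av); case/and3P: Av => _ _.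
  by rewrite -coarse_ltn //; lia.
have [[z' vz' z'c]|H] :=
    pselect (exists2 z', conn A v z' & 2 * c./2 + 3 <= coarse (m ^ k) z'.2).
  right; apply: (@v_cross_rows _ _ _ _ _ z z') => //; try lia.
  apply: conn_sub (conn_trans (conn_sym vz) vz') => x /and3P[xo x1 _] /=.
  by rewrite xo x1.
left; exists (v.1, v.2 - 2 * (c./2 * m ^ k)), (w.1, w.2 - 2 * (c./2 * m ^ k)).
split=> //; apply: conn_translate_rows => //.
apply: conn_component vw => x vx /=; have [_ /and3P[xo x1 _]] := conn_in vx.
rewrite xo x1 /= -leq_coarse_double // -coarse_ltn //.
have xc : coarse (m ^ k) x.2 < 2 * c./2 + 3.
  by rewrite ltnNge; apply/negP => xc; apply: H; exists x.
by have := cmin _ vx; lia.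
Qed.

(** By planarity an ascending and a descending crossing that exchange their vertical order must
    touch. The translates therefore form one cluster that climbs from [a] to [b + 2 * J]. *)
Lemma h_cross_glue k u h a b J s : 0 < J -> a + 3 <= b ->
  (forall j, j <= J ->
    h_cross n m k u h (pred1 a) (pred1 b) (s \o translate n m 0 j) /\
    h_cross n m k u h (pred1 b) (pred1 a) (s \o translate n m 0 j)) ->
  v_cross n m k u J (s \o translate n m 0 a./2.+1).
Proof.
move=> J0 ab H.
pose S := [pred z : nat * nat | face_open n m k s z && (z.1.+1 < 2 * (u * n ^ k))].
pose L := 2 * (u * n ^ k) - 2.
pose U c e j v w := [/\ v.1 = 0, w.1 = L, coarse (m ^ k) v.2 = c + 2 * j,
  coarse (m ^ k) w.2 = e + 2 * j & conn S v w].
have untranslate c e j :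
    h_cross n m k u h (pred1 c) (pred1 e) (s \o translate n m 0 j) ->
    exists v w, U c e j v w.
  move=> [v [w [v1 w1 /eqP vc /eqP we vw]]].
  pose f (z : nat * nat) := (z.1, z.2 + 2 * (j * m ^ k)).
  exists (f v), (f w); split; rewrite //= ?coarse_add ?vc ?we //.
  apply: (conn_map (f := f) _ _ vw) => [z /and3P[zo z1 z2]|z z' _ _].
    by move: zo; rewrite face_open_translate // !mul0n muln0 addn0 /= z1 andbT.
  by rewrite /king /=; lia.
have below x y : coarse (m ^ k) x < coarse (m ^ k) y -> x < y.
  by rewrite !ltnNge; apply: contra => /(leq_coarse (m ^ k)).
have SL z : S z -> z.1 <= L by move=> /andP[_] /=; rewrite /L; lia.
have touch c e c' e' i j v w d d' : U c e i v w -> U c' e' j d d' ->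
    c + 2 * i < c' + 2 * j -> e' + 2 * j < e + 2 * i -> conn S v d.
  move=> [v1 w1 vc we vw] [d1 d'1 dc de dd'] cc ee.
  have [||p [q [vp dq pq]]] := crossing_paths_touch SL SL vw dd' v1 w1 d1 d'1.
  - by apply: below; rewrite vc dc.
  - by apply: below; rewrite we de.
  have [_ Sq] := conn_in dq.
  by apply: conn_trans (conn_sym dq); apply: conn_rcons vp pq Sq.
(* The descending crossing at height [j] touches the ascending ones at heights [j] and [j + 1]. The
   latter starts below it because [a + 2 * j.+1 < b + 2 * j]: this is the use of [a + 3 <= b]. *)
have chain j : j <= J -> exists v0 v w,
    [/\ coarse (m ^ k) v0.2 = a, conn S v0 v & U a b j v w].
  elim: j => [|j IH] jJ.
    have [/untranslate[v [w Uvw]] _] := H 0 jJ.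
    exists v, v, w; split=> //; case: Uvw => _ _ vc _ vw; first by rewrite vc addn0.
    by apply: conn_refl; case: (conn_in vw).
  have [v0 [v [w [v0a v0v Uvw]]]] := IH (ltnW jJ).
  have [_ /untranslate[d [d' Ud]]] := H j (ltnW jJ).
  have [/untranslate[v' [w' Uvw']] _] := H j.+1 jJ.
  exists v0, v', w'; split=> //; apply: conn_trans v0v _.
  apply: (@conn_trans _ _ d).
    by apply: (touch _ _ _ _ _ _ _ _ _ _ Uvw Ud); lia.
  by apply/conn_sym/(touch _ _ _ _ _ _ _ _ _ _ Uvw' Ud); lia.
have [v0 [v [w [v0a v0v [_ _ _ wb vw]]]]] := chain J (leqnn J).
apply: (v_cross_rows J0 (conn_trans v0v vw)); lia.
Qed.

End VerticalCrossings.

Import Order.TTheory GRing.Theory Num.Theory.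
Import numFieldNormedType.Exports.
Local Open Scope ring_scope.

(** * Bernoulli expectations *)

Section Bernoulli.
Variables (R : realType) (I : choiceType).
Implicit Types (p q : R) (s t : seq I) (f g : (I -> bool) -> R)
  (x y : I -> bool) (A B : set I) (E F : set (I -> bool)).

Definition upd x i b : I -> bool := fun j => if j == i then b else x j.

(* Expectation of [f] when the coordinates in [s] are independent Bernoulli([p])
   and the others are frozen to their values in [x]. *)
Fixpoint Ex p s f x : R :=
  if s is i :: t then p * Ex p t f (upd x i true) + (1 - p) * Ex p t f (upd x i false)
  else f x.

Definition le_config x y := forall i, x i -> y i.
Definition isotone f := forall x y, le_config x y -> f x <= f y.

Lemma le_config_upd x y i (b c : bool) : le_config x y -> (b -> c) ->
  le_config (upd x i b) (upd y i c).
Proof. by move=> xy bc j; rewrite /upd; case: eqP => // _; apply: xy. Qed.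

Lemma le_upd_ft x i : le_config (upd x i false) (upd x i true).
Proof. exact: le_config_upd. Qed.

Lemma updC x i j b c : i != j -> upd (upd x i b) j c = upd (upd x j c) i b.
Proof.
move=> ij; apply/funext => k; rewrite /upd.
by case: (eqVneq k j) => [->|//]; rewrite eq_sym (negbTE ij).
Qed.

Lemma eq_Ex p s f g x : f =1 g -> Ex p s f x = Ex p s g x.
Proof. by move=> fg; elim: s x => //= i s IH x; rewrite !IH. Qed.

Lemma Ex_cst p s (c : R) x : Ex p s (fun=> c) x = c.
Proof. by elim: s x => //= i s IH x; rewrite !IH; ring. Qed.

Lemma ExD p s f g x : Ex p s (fun z => f z + g z) x = Ex p s f x + Ex p s g x.
Proof. by elim: s x => //= i s IH x; rewrite !IH !mulrDr addrACA. Qed.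

Lemma Ex_le p s f g x : 0 <= p <= 1 -> (forall z, f z <= g z) ->
  Ex p s f x <= Ex p s g x.
Proof.
move=> /andP[p0 p1] fg; elim: s x => //= i s IH x.
by apply: lerD; apply: ler_wpM2l => //; rewrite subr_ge0.
Qed.

Lemma Ex_isotone p s f : 0 <= p <= 1 -> isotone f ->
  isotone (Ex p s f).
Proof.
move=> /andP[p0 p1] fi; elim: s => //= i s IH x y xy.
by apply: lerD; apply: ler_wpM2l; rewrite ?subr_ge0 //; apply: IH;
  apply: le_config_upd.
Qed.

Lemma Ex_le_p p q s f x : 0 <= p -> p <= q -> q <= 1 -> isotone f ->
  Ex p s f x <= Ex q s f x.
Proof.
move=> p0 pq q1 fi; elim: s x => //= i s IH x.
have q01 : 0 <= q <= 1 by rewrite (le_trans p0 pq).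
have := Ex_isotone s q01 fi (@le_upd_ft x i).
have := IH (upd x i true); have := IH (upd x i false).
move: (Ex p s f _) (Ex q s f _) (Ex p s f _) (Ex q s f _) => a b c e ce ab eb.
have h1 : p * a <= p * b by rewrite ler_wpM2l.
have h2 : (1 - p) * c <= (1 - p) * e.
  by rewrite ler_wpM2l // subr_ge0 (le_trans pq).
have h3 : 0 <= (q - p) * (b - e) by rewrite mulr_ge0 // subr_ge0.
lra.
Qed.

Lemma Ex_continuous s f x : continuous (fun p => Ex p s f x).
Proof.
elim: s x => [|i s IH] x p /=; first exact: cvg_cst.
apply: cvgD; apply: cvgM; [exact: cvg_id|exact: IH| |exact: IH].
by apply: cvgB; [exact: cvg_cst|exact: cvg_id].
Qed.

Lemma Ex_swap p i j s f x : Ex p (i :: j :: s) f x = Ex p (j :: i :: s) f x.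
Proof.
have [->//|ij] := eqVneq i j.
rewrite /= !(updC _ _ _ ij); move: (Ex _ _ _ _) (Ex _ _ _ _) => a b.
by move: (Ex _ _ _ _) (Ex _ _ _ _) => c e; ring.
Qed.

Lemma Ex_cons p i s t f x : (forall y, Ex p s f y = Ex p t f y) ->
  Ex p (i :: s) f x = Ex p (i :: t) f x.
Proof. by move=> st /=; rewrite !st. Qed.

Lemma Ex_perm p s t f x : perm_eq s t -> Ex p s f x = Ex p t f x.
Proof.
elim: s t x => [|i s IH] t x st.
  by move: st; rewrite perm_sym => /perm_nilP ->.
have it : i \in t by rewrite -(perm_mem st) mem_head.
case/splitPr: it st => t1 t2 st.
have -> : Ex p (t1 ++ i :: t2) f x = Ex p (i :: t1 ++ t2) f x.
  elim: t1 x {st} => // j t1 IHt x; rewrite !cat_cons Ex_swap.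
  exact: Ex_cons.
apply: Ex_cons => y; apply: IH.
by rewrite -(perm_cons i) (permPl st) -[i :: t2]cat1s perm_catCA.
Qed.

Definition depends_on A (T : Type) (f : (I -> bool) -> T) :=
  forall x y, (forall i, A i -> x i = y i) -> f x = f y.

Lemma depends_onW A B T (f : (I -> bool) -> T) : A `<=` B -> depends_on A f ->
  depends_on B f.
Proof. by move=> AB fA x y xy; apply: fA => i /AB; apply: xy. Qed.

Lemma Ex_agree p s f A x y : depends_on A f ->
  (forall i, A i -> i \notin s -> x i = y i) -> Ex p s f x = Ex p s f y.
Proof.
move=> fA; elim: s x y => [|i s IH] x y xy /=; first by apply: fA => i /xy ->.
by congr (_ * _ + _ * _); apply: IH => j Aj js; rewrite /upd; case: eqP => // ij;
  apply: xy => //; rewrite inE negb_or js andbT; apply/eqP.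
Qed.

(** Both values of the coordinate give the same expectation: either it has no influence on [f], or
    it is drawn anew later in the list. *)
Lemma Ex_drop p i s f A x : depends_on A f -> ~ A i \/ i \in s ->
  Ex p (i :: s) f x = Ex p s f x.
Proof.
move=> fA H /=.
have E b : Ex p s f (upd x i b) = Ex p s f x.
  apply: (Ex_agree _ fA) => j Aj js; rewrite /upd; case: eqP => // ji.
  by case: H; rewrite -ji // (negbTE js).
by rewrite !E; ring.
Qed.

Lemma Ex_supp p s t f A x y : depends_on A f -> A `<=` [set` s] ->
  A `<=` [set` t] -> Ex p s f x = Ex p t f y.
Proof.
move=> fA As At.
have E u v z : A `<=` [set` v] -> Ex p (u ++ v) f z = Ex p v f z.
  move=> Av; elim: u z => //= i u IH z.
  rewrite -[LHS]/(Ex p (i :: u ++ v) f z) (Ex_drop _ _ fA) //.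
  have [Ai|] := pselect (A i); last by left.
  by right; rewrite mem_cat (Av i Ai) orbT.
rewrite -(E t s x As) (@Ex_perm p (t ++ s) (s ++ t)); last by rewrite perm_catC.
rewrite (E s t x At).
by apply: (Ex_agree _ fA) => i /At /= ->.
Qed.

Lemma Ex_mul_indep p s f g A x : depends_on A g -> (forall i, A i -> i \notin s) ->
  Ex p s (fun z => f z * g z) x = Ex p s f x * g x.
Proof.
move=> gA As; elim: s x As => //= i s IH x As.
have gx b : g (upd x i b) = g x.
  by apply: gA => j /As; rewrite inE negb_or /upd => /andP[/negbTE ->].
by rewrite !IH ?gx; [by rewrite !mulrDl -!mulrA| |] => j /As; rewrite inE negb_or => /andP[].
Qed.

Lemma Ex_cat p s t f x : Ex p (s ++ t) f x = Ex p s (Ex p t f) x.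
Proof. by elim: s x => //= i s IH x; rewrite !IH. Qed.

Lemma Ex_indep p s t f g x : depends_on [set` s] f -> depends_on [set` t] g ->
  (forall i, i \in s -> i \notin t) ->
  Ex p (s ++ t) (fun z => f z * g z) x = Ex p s f x * Ex p t g x.
Proof.
move=> fs gt st; rewrite Ex_cat.
have -> : Ex p t (fun z => f z * g z) = fun y => f y * Ex p t g x.
  apply/funext => y.
  rewrite (@eq_Ex _ _ _ (fun z => g z * f z)); last by move=> z; rewrite mulrC.
  rewrite (Ex_mul_indep _ _ _ fs st) mulrC; congr (_ * _).
  by apply: (Ex_agree _ gt) => i /= ->.
exact: (@Ex_mul_indep _ _ _ (fun=> Ex p t g x) set0).
Qed.

(** Harris' inequality, by conditioning on the first coordinate: the conditional expectations of [f]
    and [g] both grow with it, so the two-point covariance is nonnegative. *)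
Lemma Ex_harris p s f g x : 0 <= p <= 1 -> isotone f ->
  isotone g -> Ex p s f x * Ex p s g x <= Ex p s (fun z => f z * g z) x.
Proof.
move=> p01 fi gi; have /andP[p0 p1] := p01; elim: s x => //= i s IH x.
have Hf := Ex_isotone s p01 fi (@le_upd_ft x i).
have Hg := Ex_isotone s p01 gi (@le_upd_ft x i).
have := IH (upd x i true); have := IH (upd x i false).
move: Hf Hg.
move: (Ex p s f _) (Ex p s f _) (Ex p s g _) (Ex p s g _) => a c b e ac be.
move: (Ex _ _ _ _) (Ex _ _ _ _) => ab ce H1 H2.
have H3 : 0 <= p * (1 - p) * ((a - c) * (b - e)).
  by rewrite !mulr_ge0 // subr_ge0.
have H4 : p * (a * b) <= p * ab by rewrite ler_wpM2l.
have H5 : (1 - p) * (c * e) <= (1 - p) * ce by rewrite ler_wpM2l // subr_ge0.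
lra.
Qed.

Lemma Ex_map p (h : I -> I) s f x : injective h ->
  Ex p (map h s) (fun z => f (z \o h)) x = Ex p s f (x \o h).
Proof.
move=> hi; elim: s x => //= i s IH x.
by rewrite !IH; congr (_ * _ + _ * _); congr Ex; apply/funext => j;
  rewrite /upd /= (inj_eq hi).
Qed.


Definition finsupp E := exists s, depends_on [set` s] E.

(** The chosen support is immaterial by [PrE]; events without finite support get the default value
    0. *)
Definition Pr p E : R :=
  if pselect (finsupp E) is left h then Ex p (projT1 (cid h)) \1_E (fun=> false)
  else 0.

Lemma depends_on_indic A E : depends_on A E -> depends_on A (\1_E : _ -> R).
Proof.
move=> EA x y xy; rewrite !indicE; congr (nat_of_bool _)%:R.
by apply/idP/idP; rewrite !in_setE (EA x y xy).
Qed.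

(** An event supported by [s] and by [t] is supported by their intersection: pass from [y] to [z]
    through the configuration equal to [y] on [s] and to [z] elsewhere. *)
Lemma PrE p s E x : depends_on [set` s] E -> Pr p E = Ex p s \1_E x.
Proof.
move=> Es; rewrite /Pr; case: pselect => [h|]; last by case; exists s.
case: cid => t Et /=.
set A := [set` s] `&` [set` t].
have EA : depends_on A E.
  move=> y z yz; pose w i := if i \in s then y i else z i.
  rewrite (Es y w); last by move=> i /= si; rewrite /w si.
  apply: Et => i /= ti; rewrite /w; case: ifP => // si; exact: yz.
by apply: (Ex_supp _ _ _ (depends_on_indic EA)) => i [].
Qed.

Definition isotone_event E := forall x y, le_config x y -> E x -> E y.

Lemma isotone_indic E : isotone_event E -> isotone (\1_E : _ -> R).
Proof.
move=> Ei x y xy; rewrite !indicE ler_nat.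
have [|//] := boolP (x \in E); rewrite in_setE => /(Ei _ _ xy) Ey.
by rewrite (mem_set Ey).
Qed.

Lemma finsupp_restrict A E : finsupp E -> depends_on A E ->
  exists2 s : seq I, depends_on [set` s] E & forall i, i \in s -> A i.
Proof.
move=> [s Es] EA; exists [seq i <- s | `[<A i>]]; last first.
  by move=> i; rewrite mem_filter => /andP[/asboolP].
move=> y z yz; pose w i := if i \in s then y i else z i.
rewrite (Es y w); last by move=> i /= si; rewrite /w si.
apply: EA => i Ai; rewrite /w; case: ifP => // si; apply: yz => /=.
by rewrite mem_filter si andbT; apply/asboolP.
Qed.

Lemma finsuppI E F : finsupp E -> finsupp F -> finsupp (E `&` F).
Proof.
move=> [s Es] [t Ft]; exists (s ++ t) => x y xy.
by rewrite /setI /mkset (Es x y) ?(Ft x y) // => i it; apply: xy;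
  rewrite /= mem_cat it ?orbT.
Qed.

Lemma finsuppU E F : finsupp E -> finsupp F -> finsupp (E `|` F).
Proof.
move=> [s Es] [t Ft]; exists (s ++ t) => x y xy.
by rewrite /setU /mkset (Es x y) ?(Ft x y) // => i it; apply: xy;
  rewrite /= mem_cat it ?orbT.
Qed.

Lemma finsupp_common E F : finsupp E -> finsupp F ->
  exists s, depends_on [set` s] E /\ depends_on [set` s] F.
Proof.
move=> [s Es] [t Ft]; exists (s ++ t); split.
- by apply: depends_onW Es => i /= it; rewrite mem_cat it.
- by apply: depends_onW Ft => i /= it; rewrite mem_cat it orbT.
Qed.

Lemma finsupp_ex (K : eqType) (r : seq K) (E : K -> set (I -> bool)) :
  (forall i, i \in r -> finsupp (E i)) ->
  finsupp [set x | exists2 i, i \in r & E i x].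
Proof.
elim: r => [_|k r IH Er]; first by exists [::] => x y _; apply/propext; split => -[].
rewrite (_ : mkset _ = E k `|` [set x | exists2 i, i \in r & E i x]).
  apply: finsuppU; first exact/Er/mem_head.
  by apply: IH => i ir; apply: Er; rewrite inE ir orbT.
apply/seteqP; split=> x /=.
  by move=> [i]; rewrite inE => /predU1P[->|ir Ei]; [left|right; exists i].
case=> [Ek|[i ir Ei]]; first by exists k; rewrite ?mem_head.
by exists i; rewrite // inE ir orbT.
Qed.

Lemma finsupp_all (K : eqType) (r : seq K) (E : K -> set (I -> bool)) :
  (forall i, i \in r -> finsupp (E i)) ->
  finsupp [set x | forall i, i \in r -> E i x].
Proof.
elim: r => [_|k r IH Er]; first by exists [::] => x y _; apply/propext; split=> _ i.
rewrite (_ : mkset _ = E k `&` [set x | forall i, i \in r -> E i x]).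
  apply: finsuppI; first exact/Er/mem_head.
  by apply: IH => i ir; apply: Er; rewrite inE ir orbT.
apply/seteqP; split=> x /=.
  by move=> Ex0; split=> [|i ir]; apply: Ex0; rewrite inE ?eqxx // ir orbT.
by case=> Ek Er' i; rewrite inE => /predU1P[->|/Er'].
Qed.

Lemma finsupp_comp (h : I -> I) E : finsupp E -> finsupp [set x : I -> bool | E (x \o h)].
Proof.
move=> [s Es]; exists (map h s) => x y xy; apply: Es => i si /=.
by apply: xy => /=; apply: map_f.
Qed.

Lemma finsupp_coord i : finsupp [set x : I -> bool | x i].
Proof. by exists [:: i] => x y xy /=; rewrite xy //= mem_head. Qed.

Lemma isotone_eventI E F : isotone_event E -> isotone_event F ->
  isotone_event (E `&` F).
Proof. by move=> Ei Fi x y xy [/(Ei _ _ xy) ? /(Fi _ _ xy)]. Qed.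

Lemma isotone_event_all (K : eqType) (r : seq K) (E : K -> set (I -> bool)) :
  (forall i, isotone_event (E i)) ->
  isotone_event [set x | forall i, i \in r -> E i x].
Proof. by move=> Ei x y xy /= Ex0 i /Ex0; apply: Ei. Qed.

Lemma isotone_event_comp (h : I -> I) E : isotone_event E ->
  isotone_event [set x : I -> bool | E (x \o h)].
Proof. by move=> Ei x y xy /=; apply: Ei => i; apply: xy. Qed.

Section FixedParameter.
Variable p : R.
Hypothesis p01 : 0 <= p <= 1.

Lemma Pr_ge0 E : finsupp E -> 0 <= Pr p E.
Proof.
move=> [s Es]; rewrite (PrE p (fun=> false) Es).
have := @Ex_le p s (fun=> 0) \1_E (fun=> false) p01.
by rewrite Ex_cst; apply => z; rewrite indicE ler0n.
Qed.

Lemma Pr_le E F : finsupp E -> finsupp F -> E `<=` F -> Pr p E <= Pr p F.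
Proof.
move=> Ef Ff EF; have [s [Es Fs]] := finsupp_common Ef Ff.
rewrite !(PrE p (fun=> false) Es) (PrE p (fun=> false) Fs).
apply: Ex_le => // z; rewrite !indicE ler_nat.
have [|//] := boolP (z \in E); rewrite in_setE => /EF Fz.
by rewrite (mem_set Fz).
Qed.

Lemma Pr_setU E F : finsupp E -> finsupp F -> Pr p (E `|` F) <= Pr p E + Pr p F.
Proof.
move=> Ef Ff; have [s [Es Fs]] := finsupp_common Ef Ff.
have EFs : depends_on [set` s] (E `|` F).
  by move=> x y xy; rewrite /setU /mkset (Es x y xy) (Fs x y xy).
rewrite (PrE p (fun=> false) Es) (PrE p (fun=> false) Fs) (PrE p (fun=> false) EFs).
rewrite -ExD; apply: Ex_le => // z; rewrite !indicE in_setU.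
by case: (z \in E); case: (z \in F); rewrite ?addr0 ?add0r //= lerDl.
Qed.

Lemma Pr_set0 : Pr p set0 = 0.
Proof.
rewrite (@PrE p [::] set0 (fun=> false)) //=.
by rewrite indicE in_set0.
Qed.

Lemma Pr_setT : Pr p setT = 1.
Proof. by rewrite (@PrE p [::] setT (fun=> false)) //= indicT. Qed.

Lemma Pr_ex (K : eqType) (r : seq K) (E : K -> set (I -> bool)) :
  (forall i, i \in r -> finsupp (E i)) ->
  Pr p [set x | exists2 i, i \in r & E i x] <= \sum_(i <- r) Pr p (E i).
Proof.
elim: r => [_|k r IH Er].
  rewrite big_nil (_ : mkset _ = set0) ?Pr_set0 //.
  by apply/seteqP; split=> x //= -[].
have Er' i : i \in r -> finsupp (E i) by move=> ir; apply: Er; rewrite inE ir orbT.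
rewrite big_cons (_ : mkset _ = E k `|` [set x | exists2 i, i \in r & E i x]).
  apply: le_trans (Pr_setU (Er _ (mem_head _ _)) (finsupp_ex Er')) _.
  by rewrite lerD2l; apply: IH.
apply/seteqP; split=> x /=.
  by move=> [i]; rewrite inE => /predU1P[->|ir Ei]; [left|right; exists i].
case=> [Ek|[i ir Ei]]; first by exists k; rewrite ?mem_head.
by exists i; rewrite // inE ir orbT.
Qed.

Lemma Pr_harris E F : finsupp E -> finsupp F -> isotone_event E ->
  isotone_event F -> Pr p E * Pr p F <= Pr p (E `&` F).
Proof.
move=> Ef Ff Ei Fi; have [s [Es Fs]] := finsupp_common Ef Ff.
have EFs : depends_on [set` s] (E `&` F).
  by move=> x y xy; rewrite /setI /mkset (Es x y xy) (Fs x y xy).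
rewrite (PrE p (fun=> false) Es) (PrE p (fun=> false) Fs) (PrE p (fun=> false) EFs).
apply: le_trans (Ex_harris s _ p01 (isotone_indic Ei) (isotone_indic Fi)) _.
by apply: Ex_le => // z; rewrite indicI.
Qed.

Lemma Pr_harris_all (K : eqType) (r : seq K) (E : K -> set (I -> bool)) e :
  0 <= e -> (forall i, finsupp (E i)) -> (forall i, isotone_event (E i)) ->
  (forall i, i \in r -> e <= Pr p (E i)) ->
  e ^+ size r <= Pr p [set x | forall i, i \in r -> E i x].
Proof.
move=> e0 Ef Ei; elim: r => [_|k r IH Er].
  rewrite expr0 (_ : mkset _ = setT) ?Pr_setT //.
  by apply/seteqP; split=> x.
rewrite (_ : mkset _ = E k `&` [set x | forall i, i \in r -> E i x]).
  rewrite /= exprS; apply: le_trans (Pr_harris _ _ _ _) => //.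
  - apply: ler_pM; rewrite ?exprn_ge0 ?Er ?mem_head //.
    by apply: IH => i ir; apply: Er; rewrite inE ir orbT.
  - exact: finsupp_all.
  - exact: isotone_event_all.
apply/seteqP; split=> x /=.
  by move=> Ex0; split=> [|i ir]; apply: Ex0; rewrite inE ?eqxx // ir orbT.
by case=> Ek Er' i; rewrite inE => /predU1P[->|/Er'].
Qed.

Lemma Pr_indep A B E F : finsupp E -> finsupp F -> depends_on A E ->
  depends_on B F -> (forall i, A i -> ~ B i) ->
  Pr p (E `&` F) = Pr p E * Pr p F.
Proof.
move=> Ef Ff EA FB AB.
have [s Es sA] := finsupp_restrict Ef EA.
have [t Ft tB] := finsupp_restrict Ff FB.
have EFs : depends_on [set` s ++ t] (E `&` F).
  move=> x y xy.
  by rewrite /setI /mkset (Es x y) ?(Ft x y) // => i it; apply: xy;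
    rewrite /= mem_cat it ?orbT.
rewrite (PrE p (fun=> false) Es) (PrE p (fun=> false) Ft) (PrE p (fun=> false) EFs).
rewrite -(Ex_indep _ _ (depends_on_indic Es) (depends_on_indic Ft)).
  by apply: eq_Ex => z; rewrite indicI.
by move=> i /sA Ai; apply/negP => /tB; apply: AB.
Qed.

Lemma Pr_indep_all (K : eqType) (r : seq K) (A : K -> set I)
    (E : K -> set (I -> bool)) : uniq r -> (forall i, finsupp (E i)) ->
  (forall i, depends_on (A i) (E i)) ->
  (forall i j k, i != j -> A i k -> ~ A j k) ->
  Pr p [set x | forall i, i \in r -> E i x] = \prod_(i <- r) Pr p (E i).
Proof.
move=> ur Ef EA disj; elim: r ur => [_|k r IH /= /andP[kr ur]].
  rewrite big_nil (_ : mkset _ = setT) ?Pr_setT //.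
  by apply/seteqP; split=> x.
rewrite big_cons -IH // (_ : mkset _ = E k `&` [set x | forall i, i \in r -> E i x]).
  apply: (@Pr_indep (A k) (\bigcup_(i in [set` r]) A i)) => //.
  - exact: finsupp_all.
  - move=> x y xy; apply/propext; split=> H i ir; have := H i ir;
      by rewrite (EA i x y) // => j Aj; apply: xy; exists i.
  - move=> i Ai [j /= jr]; apply: disj Ai.
    by apply: contraNneq kr => ->.
apply/seteqP; split=> x /=.
  by move=> Ex0; split=> [|i ir]; apply: Ex0; rewrite inE ?eqxx // ir orbT.
by case=> Ek Er' i; rewrite inE => /predU1P[->|/Er'].
Qed.

Lemma Pr_comp (h : I -> I) E : finsupp E -> injective h ->
  Pr p [set x : I -> bool | E (x \o h)] = Pr p E.
Proof.
move=> [s Es] hi.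
have Ehs : depends_on [set` map h s] [set x : I -> bool | E (x \o h)].
  by move=> x y xy; apply: Es => i si /=; apply: xy => /=; apply: map_f.
rewrite (PrE p (fun=> false) Ehs) (PrE p ((fun=> false) \o h) Es) -(Ex_map _ _ _ _ hi).
exact: eq_Ex.
Qed.

Lemma Pr_has s : uniq s -> Pr p [set x : I -> bool | has x s] = 1 - (1 - p) ^+ size s.
Proof.
move=> us; have Hs : depends_on [set` s] [set x : I -> bool | has x s].
  by move=> x y xy /=; rewrite (@eq_in_has _ x y).
rewrite (PrE p (fun=> false) Hs) (@eq_Ex _ _ _ (fun z => (has z s)%:R)); last first.
  move=> z; rewrite indicE; congr (nat_of_bool _)%:R.
  by apply/idP/idP; rewrite in_setE.
have none x : Ex p s (fun z => (~~ has z s)%:R) x = (1 - p) ^+ size s.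
  elim: s us x {Hs} => [//|i s IH /= /andP[si us] x].
  have E y : Ex p s (fun z => (~~ (z i || has z s))%:R) y =
      (1 - p) ^+ size s * (~~ y i)%:R.
    rewrite (@eq_Ex _ _ _ (fun z => (~~ has z s)%:R * (~~ z i)%:R)); last first.
      by move=> z; rewrite negb_or andbC -natrM mulnb.
    rewrite (@Ex_mul_indep _ _ _ (fun z => (~~ z i)%:R) [set i]) ?IH //.
      by move=> y1 y2 /(_ _ erefl) ->.
    by move=> _ ->.
  by rewrite !E /upd eqxx !mulr0 add0r mulr1 exprS.
have E : Ex p s (fun z => (has z s)%:R) (fun=> false) +
    Ex p s (fun z => (~~ has z s)%:R) (fun=> false) = 1.
  rewrite -ExD -[RHS](Ex_cst p s 1 (fun=> false)); apply: eq_Ex => z.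
  by case: (has z s); rewrite ?addr0 ?add0r.
by apply/eqP; rewrite -(none (fun=> false)) eq_sym subr_eq E.
Qed.


Lemma Pr_coord i : Pr p [set x : I -> bool | x i] = p.
Proof.
have := @Pr_has [:: i] isT; rewrite expr1 opprB addrC subrK => E.
by rewrite -[RHS]E; congr (Pr p _); apply/seteqP; split=> x /=; rewrite orbF.
Qed.

End FixedParameter.

Lemma Pr_le_p p q E : finsupp E -> isotone_event E -> 0 <= p -> p <= q -> q <= 1 ->
  Pr p E <= Pr q E.
Proof.
move=> [s Es] Ei p0 pq q1.
rewrite (PrE p (fun=> false) Es) (PrE q (fun=> false) Es).
exact/Ex_le_p/isotone_indic.
Qed.

Lemma Pr_continuous E : finsupp E -> continuous (Pr ^~ E).
Proof.
move=> [s Es]; rewrite (_ : Pr^~ E = fun p => Ex p s \1_E (fun=> false)).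
  exact: Ex_continuous.
by apply/funext => p; apply: PrE.
Qed.

End Bernoulli.

(** * Crossing probabilities *)

Lemma shift_level_inj j : injective (shift_level j).
Proof. by move=> [[l a] b] [[l' a'] b'] [/addnI -> -> ->]. Qed.

Lemma translate_inj n m a b : injective (translate n m a b).
Proof. by move=> [[l c] d] [[l' c'] d'] [/= -> /addIn -> /addIn ->]. Qed.

Lemma transpose_inj : injective transpose.
Proof. by move=> [[l c] d] [[l' c'] d'] [/= -> -> ->]. Qed.

Lemma reflect_columns_inj n u : injective (reflect_columns n u).
Proof.
move=> [[l c] d] [[l' c'] d']; rewrite /reflect_columns /= => -[->].
move: (u * n ^ l')%N => N; case: ifP => cN; case: ifP => c'N => + -> => E;
  congr (_, _, _); lia.
Qed.

Section Positive.
Variable R : realType.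
Let I := (nat * nat * nat)%type : choiceType.
Implicit Types (p q e : R).

(** For decreasing events this says that the limit of their probabilities is positive. *)
Definition positive p (E : nat -> set (I -> bool)) :=
  exists2 e, 0 < e & forall k, e <= Pr p (E k).

Lemma Pr_antitone p (E : nat -> set (I -> bool)) : 0 <= p <= 1 ->
  (forall k, finsupp (E k)) -> (forall k, E k.+1 `<=` E k) ->
  forall k l, (k <= l)%N -> Pr p (E l) <= Pr p (E k).
Proof.
move=> p01 Ef Ed k l kl; rewrite -(subnK kl); elim: (l - k)%N => [//|j IH].
by apply: le_trans IH; rewrite addSn; apply: Pr_le.
Qed.

(** If the first sequence is not positive, its probability is below [e / 2] from some level on,
    which leaves [e / 2] to the others at deep levels, and by monotonicity at all levels. *)
Lemma positive_pigeonhole p (K : eqType) (r : seq K)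
    (E : K -> nat -> set (I -> bool)) e : 0 <= p <= 1 -> 0 < e ->
  (forall i k, finsupp (E i k)) -> (forall i k, E i k.+1 `<=` E i k) ->
  (forall k, e <= \sum_(i <- r) Pr p (E i k)) ->
  exists2 i, i \in r & positive p (E i).
Proof.
move=> p01 e0 Ef Ed; elim: r e e0 => [e e0 /(_ 0%N)|i r IH e e0 H].
  by rewrite big_nil leNgt e0.
have [Ei|Ei] := pselect (positive p (E i)); first by exists i; rewrite ?mem_head.
have [k0 k0e] : exists k, Pr p (E i k) < e / 2.
  apply: contrapT => /forallNP N; apply: Ei; exists (e / 2); first lra.
  by move=> k; rewrite leNgt; apply/negP/N.
have [||j jr Ej] := IH (e / 2); [lra| |by exists j; rewrite // inE jr orbT].
move=> k; apply: (@le_trans _ _ (\sum_(j <- r) Pr p (E j (maxn k k0)))).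
  have := H (maxn k k0); rewrite big_cons.
  have := Pr_antitone p01 (Ef i) (Ed i) (leq_maxr k k0).
  lra.
by apply: ler_sum => j _; apply: Pr_antitone => //; apply: leq_maxl.
Qed.

Lemma expr_small (x e : R) : 0 <= x < 1 -> 0 < e ->
  exists K, forall k, (K <= k)%N -> x ^+ k < e.
Proof.
move=> /andP[x0 x1] e0.
have /cvgrPdist_lt/(_ e e0) [K _ HK] : (x ^+ k @[k --> \oo] --> 0)%R.
  by apply: cvg_expr; rewrite ger0_norm.
exists K => k Kk; have := HK k Kk.
by rewrite /= sub0r normrN ger0_norm // exprn_ge0.
Qed.

(** The exponent [n ^ K] outgrows every multiple of [K], so the last factor is eventually below
    [(2 * m.+1)^-1 ^+ K]. *)
Lemma exp_tower_small (C e rho : R) (n m : nat) : (1 < n)%N -> 0 <= rho < 1 ->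
  0 <= C -> 0 < e ->
  exists2 K, (0 < K)%N & C * m%:R ^+ K * rho ^+ (n ^ K) < e.
Proof.
move=> n1 rho01 C0 e0.
have M0 : 0 < 2 * m.+1%:R :> R by rewrite mulr_gt0.
have [K0 /(_ _ (leqnn _)) rK0] : exists K, forall k, (K <= k)%N ->
    rho ^+ k < (2 * m.+1%:R)^-1 by apply: expr_small; rewrite ?invr_gt0.
have [J HJ] : exists J, forall j, (J <= j)%N -> (2^-1 : R) ^+ j < e / (C + 1).
  by apply: expr_small; [lra|rewrite divr_gt0 //; lra].
have /andP[rho0 rho1] := rho01.
(* With [K = 2 * j], the inequality [K0 * K <= 2 ^ K] splits into [K0 * 2 <= 2 ^ j] and
   [j <= 2 ^ j]. *)
pose j := (2 * K0 + J).+1; exists (2 * j)%N => //.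
set K := (2 * j)%N.
have nK : (K0 * K <= n ^ K)%N.
  apply: (@leq_trans (2 ^ K)); last by rewrite leq_exp2r // /K; lia.
  rewrite /K mulnA expnM (_ : 2 ^ 2 = 2 * 2)%N // expnMn.
  apply: leq_mul; last exact/ltnW/ltn_expl.
  by apply: (@leq_trans j); [rewrite /j; lia|exact/ltnW/ltn_expl].
have lt1 : rho ^+ (n ^ K) <= (2 * m.+1%:R)^-1 ^+ K.
  apply: (@le_trans _ _ (rho ^+ (K0 * K))).
    by apply: ler_wiXn2l => //; apply: ltW.
  by rewrite exprM lerXn2r // ?nnegrE ?exprn_ge0 ?invr_ge0 // ltW.
have lt2 : m%:R ^+ K * rho ^+ (n ^ K) <= 2^-1 ^+ K.
  apply: (@le_trans _ _ (m.+1%:R ^+ K * (2 * m.+1%:R)^-1 ^+ K)).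
    apply: ler_pM; rewrite ?exprn_ge0 //.
    by rewrite lerXn2r // ?nnegrE ?ler0n // ler_nat leqnSn.
  by rewrite -exprMn_comm; [|exact: mulrC]; rewrite invfM mulrCA divff ?mulr1 // pnatr_eq0.
have H := HJ K; rewrite ltr_pdivlMr in H; last lra.
rewrite -mulrA; apply: le_lt_trans (_ : C * 2^-1 ^+ K < e).
  by rewrite ler_wpM2l.
apply: le_lt_trans (H _); last by rewrite /K /j; lia.
have : 0 <= 2^-1 ^+ K :> R by rewrite exprn_ge0.
lra.
Qed.

End Positive.

Section CrossingEvents.
Variables (R : realType) (n m : nat).
Hypotheses (n_gt0 : (0 < n)%N) (m_gt0 : (0 < m)%N).
Let I := (nat * nat * nat)%type : choiceType.
Let nk k : (0 < n ^ k)%N. Proof. by rewrite expn_gt0 n_gt0. Qed.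
Let mk k : (0 < m ^ k)%N. Proof. by rewrite expn_gt0 m_gt0. Qed.

Lemma finsupp_h_cross k W h (P Q : pred nat) :
  finsupp (h_cross n m k W h P Q : set (I -> bool)).
Proof.
exists [seq (x, b) | x <- [seq (l, a) | l <- iota 0 k.+1, a <- iota 0 (W * n ^ k)],
   b <- iota 0 (h * m ^ k)].
have mem_index l a b : (0 < l <= k)%N -> (a < W * n ^ l)%N -> (b < h * m ^ l)%N ->
    (l, a, b) \in [seq (x, b) | x <- [seq (l, a) | l <- iota 0 k.+1, a <- iota 0 (W * n ^ k)],
      b <- iota 0 (h * m ^ k)].
  move=> /andP[l0 lk] aW bh; apply/allpairsP; exists ((l, a), b); split=> //; last first.
    rewrite mem_iota /=; apply: leq_trans bh _.
    by rewrite leq_mul2l leq_pexp2l ?orbT.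
  apply/allpairsPdep; exists l, a; rewrite !mem_iota ltnS lk; split=> //.
  by apply: leq_trans aW _; rewrite leq_mul2l leq_pexp2l ?orbT.
move=> s t st; apply/propext; split; apply: h_cross_depends => // l a b lk aW bh;
  [|apply/esym]; exact/st/mem_index.
Qed.

Lemma isotone_h_cross k W h (P Q : pred nat) :
  isotone_event (h_cross n m k W h P Q : set (I -> bool)).
Proof. by move=> s t st; apply: h_cross_isotone. Qed.

(** The quotient is the unit column of a rectangle, so distinct unit columns use disjoint sets of
    coordinates and are independent. *)
Lemma depends_on_column k h i : depends_on [set j : I | (j.1.2 %/ n ^ j.1.1)%N = i]
  [set s : I -> bool | h_cross n m k 1 h predT predT (s \o translate n m i 0)].
Proof.
move=> s t st; apply/propext; split; apply: h_cross_depends => // l a b lk aW bh;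
  [|apply/esym]; apply: st => /=; rewrite divnDMl // divn_small //;
  by rewrite -(mul1n (n ^ l)%N).
Qed.

Lemma Pr_h_cross_reflect (p : R) k W h (P Q : pred nat) : 0 <= p <= 1 ->
  Pr p (h_cross n m k W h P Q) <= Pr p (h_cross n m k W h Q P).
Proof.
move=> p01; rewrite -(Pr_comp p (finsupp_h_cross k W h P Q) (@reflect_columns_inj n W)).
apply: Pr_le => //; [exact/finsupp_comp/finsupp_h_cross|exact: finsupp_h_cross|].
by move=> s /= /h_cross_reflect; apply.
Qed.

Lemma Pr_v_cross (p : R) k W h :
  Pr p (v_cross m n k W h) = Pr p (h_cross n m k h W predT predT).
Proof.
exact: (Pr_comp p (finsupp_h_cross k h W predT predT) transpose_inj).
Qed.

Lemma finsupp_v_cross k W h : finsupp (v_cross m n k W h : set (I -> bool)).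
Proof. exact/finsupp_comp/finsupp_h_cross. Qed.

Lemma Pr_h_cross_join (p : R) j k h : 0 <= p <= 1 -> (h <= m ^ j)%N ->
  p ^+ (j * (n ^ j * m ^ j)) * Pr p (h_cross n m k (n ^ j) h predT predT) <=
  Pr p (h_cross n m (j + k) 1 1 predT predT).
Proof.
move=> p01 hj; have /andP[p0 p1] := p01.
(* Every level is given the index range of level [j], which makes the number of required selections
   simple. *)
pose r : seq I := [seq (x, b) | x <- [seq (l, a) | l <- iota 1 j, a <- iota 0 (n ^ j)],
  b <- iota 0 (m ^ j)].
have rs : size r = (j * (n ^ j * m ^ j))%N by rewrite !size_allpairs !size_iota mulnA.
pose E (i : I) := [set s : I -> bool | s i].
have rE : p ^+ size r <= Pr p [set s : I -> bool | forall i, i \in r -> E i s].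
  apply: Pr_harris_all => // i; first exact: finsupp_coord.
  - by move=> s t st; apply: (st i).
  - by rewrite Pr_coord.
rewrite -rs -(Pr_comp p (finsupp_h_cross k (n ^ j) h predT predT) (@shift_level_inj j)).
have fsh := @finsupp_comp I (shift_level j) _ (finsupp_h_cross k (n ^ j) h predT predT).
apply: le_trans (ler_wpM2r _ rE) _.
  exact/(Pr_ge0 p01)/fsh.
have fE : finsupp [set s : I -> bool | forall i, i \in r -> E i s].
  by apply: finsupp_all => i _; apply: finsupp_coord.
apply: le_trans (Pr_harris p01 fE fsh _ _) _.
- by apply: isotone_event_all => i s t st; apply: (st i).
- exact: (@isotone_event_comp I (shift_level j) _ (@isotone_h_cross k (n ^ j) h predT predT)).
apply: Pr_le => //.
- exact: finsuppI.
- exact: finsupp_h_cross.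
move=> s [/= full sh]; apply: (h_cross_join n_gt0 m_gt0 hj _ sh) => l a b /andP[l0 lj] al bl.
apply: full; apply/allpairsP; exists ((l, a), b); split=> //; last first.
  by rewrite mem_iota /=; apply: leq_trans bl _; rewrite leq_pexp2l.
apply/allpairsPdep; exists l, a; rewrite !mem_iota l0 add1n ltnS lj; split=> //.
by apply: leq_trans al _; rewrite leq_pexp2l.
Qed.

Lemma positive_h_cross_join (p : R) j h : 0 < p <= 1 -> (h <= m ^ j)%N ->
  positive p (fun k => h_cross n m k (n ^ j) h predT predT) ->
  positive p (fun k => h_cross n m k 1 1 predT predT).
Proof.
move=> /andP[p0 p1] hj [e e0 He]; have p01 : 0 <= p <= 1 by rewrite ltW.
exists (p ^+ (j * (n ^ j * m ^ j)) * e); first by rewrite mulr_gt0 ?exprn_gt0.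
move=> k; apply: (@le_trans _ _ (Pr p (h_cross n m (j + k) 1 1 predT predT))).
  apply: le_trans (Pr_h_cross_join k p01 hj).
  by rewrite ler_wpM2l ?exprn_ge0 // ltW.
apply: (@Pr_antitone _ p (fun k => h_cross n m k 1 1 predT predT) p01) => [l|l s|];
  [exact: finsupp_h_cross| |exact: leq_addl].
exact: h_cross_antitone.
Qed.

Lemma Pr_some_open (p : R) K x c : 0 <= p <= 1 ->
  Pr p [set s : I -> bool | has (fun b => s (K, x, b)) (iota c 4)] = 1 - (1 - p) ^+ 4.
Proof.
move=> p01; have u : uniq [seq (K, x, b) | b <- iota c 4].
  by rewrite map_inj_uniq ?iota_uniq // => b b' [].
have := Pr_has p u; rewrite size_map size_iota => <-.
by congr (Pr p _); apply/seteqP; split=> s /=; rewrite has_map.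
Qed.

(** A union bound over the [h] positions of a band of four rows, in which the columns are
    independent. *)
Lemma Pr_line (p : R) K W h : 0 <= p <= 1 ->
  Pr p [set s : I -> bool | exists2 c, c \in iota 0 h & forall x, x \in iota 0 W ->
     has (fun b => s (K, x, b)) (iota c 4)] <= h%:R * (1 - (1 - p) ^+ 4) ^+ W.
Proof.
move=> p01.
pose E c x := [set s : I -> bool | has (fun b => s (K, x, b)) (iota c 4)].
have f1 c x : finsupp (E c x).
  exists [seq (K, x, b) | b <- iota c 4] => s t st.
  by congr is_true; apply: eq_in_has => b bc; apply: st; apply: (map_f (pair (K, x))).
apply: le_trans (Pr_ex p01 (E := fun c => [set s : I -> bool | forall x,
     x \in iota 0 W -> E c x s]) _) _.
  by move=> c _; apply: finsupp_all.
rewrite (eq_bigr (fun=> (1 - (1 - p) ^+ 4) ^+ W)).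
  by rewrite big_const_seq count_predT size_iota iter_addr_0 mulr_natl.
move=> c _; rewrite (Pr_indep_all p (A := fun x => [set i : I | i.1.2 = x]) _ (f1 c)) ?iota_uniq //.
- rewrite (eq_bigr (fun=> 1 - (1 - p) ^+ 4)); last by move=> x _; rewrite Pr_some_open.
  by rewrite big_const_seq count_predT size_iota iter_mulr_1.
- by move=> x s t st; congr is_true; apply: eq_in_has => b _; apply: st.
- by move=> x y j /eqP xy /= jx jy; apply: xy; rewrite -jx -jy.
Qed.

End CrossingEvents.

(** * Duality between horizontal and vertical crossings *)

Section Duality.
Variables (R : realType) (n m : nat) (p : R).
Hypotheses (n_gt1 : (1 < n)%N) (m_gt1 : (1 < m)%N) (p_gt0 : 0 < p) (p_lt1 : p < 1).
Let I := (nat * nat * nat)%type : choiceType.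
Let n_gt0 : (0 < n)%N := ltnW n_gt1.
Let m_gt0 : (0 < m)%N := ltnW m_gt1.
Let p01 : 0 <= p <= 1. Proof. by rewrite !ltW. Qed.

Lemma Pr_translate k W h (P Q : pred nat) a b :
  Pr p [set s : I -> bool | h_cross n m k W h P Q (s \o translate n m a b)] =
  Pr p (h_cross n m k W h P Q).
Proof.
exact: (Pr_comp p (finsupp_h_cross n_gt0 m_gt0 k W h P Q) (@translate_inj n m a b)).
Qed.

(** For large [K] the nearly level alternative of [h_cross_slopes] has probability below [e / 2].
    The other [e / 2] is shared by finitely many types [(u, a, b)] of sloped crossings, and the
    pigeonhole principle selects one of them. *)
Lemma positive_sloped_crossing W h : (0 < W)%N ->
  positive p (fun k => h_cross n m k W h predT predT) ->
  exists u H a b, (a + 3 <= b)%N /\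
    positive p (fun k => h_cross n m k u H (pred1 a) (pred1 b)).
Proof.
move=> W0 [e e0 He].
pose rho := 1 - (1 - p) ^+ 4.
have q01 : 0 < (1 - p) ^+ 4 <= 1.
  by rewrite exprn_gt0 ?subr_gt0 //= exprn_ile1 ?subr_ge0 ?gerBl ?ltW.
have rho01 : 0 <= rho < 1 by rewrite /rho; lra.
have [K K0 HK] := @exp_tower_small R h%:R (e / 2) rho n m n_gt1 rho01 (ler0n _ _)
  ltac:(lra).
pose A := (W * n ^ K)%N; pose H := (h * m ^ K)%N.
pose good (x : nat * nat * nat) := (x.1.2 + 3 <= x.2)%N || (x.2 + 3 <= x.1.2)%N.
pose r := [seq x <- [seq (y, b) | y <- [seq (u, a) | u <- iota 0 A.+1, a <- iota 0 (2 * H)],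
  b <- iota 0 (2 * H)] | good x].
pose E (x : nat * nat * nat) k : set (I -> bool) :=
  h_cross n m k x.1.1 H (pred1 x.1.2) (pred1 x.2).
pose L := [set s : I -> bool | exists2 c, c \in iota 0 H & forall x, x \in iota 0 A ->
     has (fun b => s (K, x, b)) (iota c 4)].
have fE x k : finsupp (E x k) by exact: finsupp_h_cross.
have fEs x k := @finsupp_comp I (shift_level K) _ (fE x k).
have fL : finsupp L.
  apply: (@finsupp_ex I _ _ (fun c => [set s : I -> bool | forall x, x \in iota 0 A ->
     [set s : I -> bool | has (fun b => s (K, x, b)) (iota c 4)] s])) => c _.
  apply: finsupp_all => x _; exists [seq (K, x, b) | b <- iota c 4] => s t st.
  by congr is_true; apply: eq_in_has => b bc; apply: st; apply: (map_f (pair (K, x))).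
have PL : Pr p L < e / 2.
  apply: le_lt_trans (Pr_line K A H p01) _; apply: le_lt_trans HK.
  rewrite natrM natrX ler_wpM2l ?mulr_ge0 ?exprn_ge0 ?ler0n //.
  by apply: ler_wiXn2l; rewrite ?leq_pmull //; lra.
have sumE k : e / 2 <= \sum_(x <- r) Pr p (E x k).
  have : Pr p (h_cross n m (K + k) W h predT predT : set (I -> bool)) <=
      Pr p (L `|` [set s | exists2 x, x \in r &
        [set s : I -> bool | E x k (s \o shift_level K)] s]).
    apply: Pr_le => //; first exact: finsupp_h_cross.
      by apply: finsuppU => //; apply: finsupp_ex => x _; apply: fEs.
    move=> s /(h_cross_slopes n_gt0 m_gt0 K0)[[c cH cx]|[u [a [b [uA aH bH ab Es]]]]].
      left; exists c; first by rewrite mem_iota.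
      by move=> x; rewrite mem_iota; apply: cx.
    right; exists (u, a, b) => //; rewrite mem_filter; apply/andP; split=> //.
    apply/allpairsP; exists ((u, a), b); rewrite mem_iota; split=> //.
    by apply/allpairsPdep; exists u, a; rewrite !mem_iota ltnS.
  move/(le_trans (He _))/le_trans/(_ (Pr_setU p01 fL (finsupp_ex (fun x _ => fEs x k)))).
  have := Pr_ex p01 (r := r) (fun x _ => fEs x k).
  rewrite (eq_bigr (fun x => Pr p (E x k))); last first.
    by move=> x _; rewrite (Pr_comp p (fE x k) (@shift_level_inj K)).
  lra.
have [|||[[u a] b]] := positive_pigeonhole p01 _ _ _ sumE; [lra|by []| |].
  by move=> x k s; apply: h_cross_antitone.
rewrite mem_filter /good /= => /andP[/orP[ab|ba] _] pos.
  by exists u, H, a, b.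
(* Reflection turns a descending crossing into an ascending one. *)
exists u, H, b, a; split=> //; case: pos => e' e'0 He'; exists e' => // k.
exact/(le_trans (He' k))/Pr_h_cross_reflect.
Qed.

(** By Harris' inequality the ascending and descending crossings at the heights 0 to [J] occur
    together with a probability bounded below uniformly in [k]; [h_cross_glue] joins them. *)
Lemma positive_long_vertical u H a b J : (0 < J)%N -> (a + 3 <= b)%N ->
  positive p (fun k => h_cross n m k u H (pred1 a) (pred1 b)) ->
  positive p (fun k => v_cross n m k u J).
Proof.
move=> J0 ab [e e0 He]; exists ((e * e) ^+ J.+1); first by rewrite exprn_gt0 ?mulr_gt0.
move=> k.
pose U j := [set s : I -> bool | h_cross n m k u H (pred1 a) (pred1 b) (s \o translate n m 0 j)].
pose D j := [set s : I -> bool | h_cross n m k u H (pred1 b) (pred1 a) (s \o translate n m 0 j)].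
have fU j : finsupp (U j).
  exact: (@finsupp_comp I (translate n m 0 j) _ (finsupp_h_cross n_gt0 m_gt0 _ _ _ _ _)).
have fD j : finsupp (D j).
  exact: (@finsupp_comp I (translate n m 0 j) _ (finsupp_h_cross n_gt0 m_gt0 _ _ _ _ _)).
have iU j : isotone_event (U j).
  exact: (@isotone_event_comp I (translate n m 0 j) _ (@isotone_h_cross n m n_gt0 m_gt0 _ _ _ _ _)).
have iD j : isotone_event (D j).
  exact: (@isotone_event_comp I (translate n m 0 j) _ (@isotone_h_cross n m n_gt0 m_gt0 _ _ _ _ _)).
have UD j : e * e <= Pr p (U j `&` D j).
  apply: le_trans (Pr_harris p01 (fU j) (fD j) (iU j) (iD j)).
  apply: ler_pM; rewrite ?(ltW e0) // Pr_translate //.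
  by apply: le_trans (He k) _; apply: Pr_h_cross_reflect.
have := @Pr_harris_all R I p p01 _ (iota 0 J.+1) (fun j => U j `&` D j) (e * e)
  (ltW (mulr_gt0 e0 e0)) (fun j => finsuppI (fU j) (fD j))
  (fun j => isotone_eventI (iU j) (iD j)) (fun j _ => UD j).
rewrite size_iota => /le_trans; apply.
have fV : finsupp (v_cross n m k u J : set (I -> bool)) by exact: finsupp_v_cross.
rewrite -(Pr_comp p fV (@translate_inj n m 0 (a./2.+1))).
apply: Pr_le => //; [|exact: finsupp_comp|].
  by apply: finsupp_all => j _; apply: finsuppI.
move=> s Hs; apply: (h_cross_glue n_gt0 m_gt0 (a := a) (b := b) J0 ab) => j jJ.
by apply: Hs; rewrite mem_iota.
Qed.

Theorem positive_crossing_dual W h : (0 < W)%N ->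
  positive p (fun k => h_cross n m k W h predT predT) ->
  positive p (fun k => h_cross m n k 1 1 predT predT).
Proof.
move=> W0 /(positive_sloped_crossing W0)[u [H [a [b [ab pos]]]]].
(* A box [u] cells wide and [m ^ u] cells high, scaled down by [u] levels, has the height of the
   unit square, and it fits into its width because [u <= n ^ u]. *)
have un : (u <= n ^ u)%N by exact/ltnW/ltn_expl.
have mu : (0 < m ^ u)%N by rewrite expn_gt0 m_gt0.
have [e e0 He] := positive_long_vertical mu ab pos.
apply: (@positive_h_cross_join R m n m_gt0 n_gt0 p u u) => //.
  by rewrite p_gt0 ltW.
exists e => // k; apply: le_trans (He k) _.
by rewrite (Pr_v_cross m_gt0 n_gt0).
Qed.

End Duality.

(** * Finite size criterion and positivity at the critical point *)

Section Renormalization.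
Variable R : realType.
Let I := (nat * nat * nat)%type : choiceType.

(** A union bound over the alternatives of [h_cross_two_rows]. The vertical crossing of one cell is
    enlarged to one of two cells side by side, which makes the bound symmetric under exchange of [n]
    and [m]. *)
Lemma Pr_h_cross_tall (n m N k : nat) (p : R) : (0 < n)%N -> (0 < m)%N -> 0 <= p <= 1 ->
  Pr p (h_cross n m k 1 N predT predT) <=
  N%:R * (Pr p (h_cross n m k 1 2 predT predT) + Pr p (h_cross m n k 1 2 predT predT)).
Proof.
move=> n0 m0 p01.
pose H r := [set s : I -> bool | h_cross n m k 1 2 predT predT (s \o translate n m 0 r)].
pose V r := [set s : I -> bool | v_cross n m k 1 1 (s \o translate n m 0 r.+1)].
have fh : finsupp (h_cross n m k 1 2 predT predT : set (I -> bool)) by exact: finsupp_h_cross.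
have fv : finsupp (v_cross n m k 1 1 : set (I -> bool)) by exact: finsupp_v_cross.
have fH r : finsupp (H r) by exact: (@finsupp_comp I (translate n m 0 r)).
have fV r : finsupp (V r) by exact: (@finsupp_comp I (translate n m 0 r.+1)).
have fHV r : finsupp (H r `|` V r) by exact: finsuppU.
apply: (@le_trans _ _ (Pr p [set s | exists2 r, r \in iota 0 N & (H r `|` V r) s])).
  apply: Pr_le => //; [exact: finsupp_h_cross|exact: finsupp_ex|].
  move=> s /(h_cross_two_rows n0 m0)[r rN Hr]; exists r => //.
  by rewrite mem_iota.
apply: le_trans (Pr_ex p01 (fun r _ => fHV r)) _.
apply: (@le_trans _ _ (\sum_(r <- iota 0 N) (Pr p (h_cross n m k 1 2 predT predT) +
    Pr p (h_cross m n k 1 2 predT predT)))); last first.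
  by rewrite big_const_seq count_predT size_iota iter_addr_0 mulr_natl.
apply: ler_sum => r _; apply: le_trans (Pr_setU p01 (fH r) (fV r)) _.
rewrite (Pr_comp p fh (@translate_inj n m 0 r)).
rewrite (Pr_comp p fv (@translate_inj n m 0 r.+1)) lerD2l (Pr_v_cross m0 n0).
apply: Pr_le => //; [exact: finsupp_h_cross|exact: finsupp_h_cross|].
by move=> s; apply: h_cross_W.
Qed.

(** One level deeper the box consists of at least two columns of [2 * m] cells. The crossings of the
    first two columns are independent, whence the square. *)
Lemma Pr_h_cross_renormalize (n m k : nat) (p : R) : (1 < n)%N -> (0 < m)%N -> 0 <= p <= 1 ->
  Pr p (h_cross n m k.+1 1 2 predT predT) <=
  ((2 * m)%:R * (Pr p (h_cross n m k 1 2 predT predT) +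
                 Pr p (h_cross m n k 1 2 predT predT))) ^+ 2.
Proof.
move=> n1 m0 p01; have n0 : (0 < n)%N := ltnW n1.
pose E i := [set s : I -> bool | h_cross n m k 1 (2 * m) predT predT (s \o translate n m i 0)].
have fh : finsupp (h_cross n m k 1 (2 * m) predT predT : set (I -> bool)).
  exact: finsupp_h_cross.
have fE i : finsupp (E i) by exact: (@finsupp_comp I (translate n m i 0)).
pose F := [set s : I -> bool | forall i, i \in iota 0 2 -> E i s].
have fF : finsupp F by exact: finsupp_all.
apply: (@le_trans _ _ (Pr p [set s : I -> bool | F (s \o shift_level 1)])).
  apply: Pr_le => //; [exact: finsupp_h_cross|exact: (@finsupp_comp I (shift_level 1))|].
  move=> s; rewrite -add1n => /(h_cross_shift n0 m0); rewrite mul1n !expn1 => Hs i.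
  by rewrite mem_iota => i2; apply: (h_cross_column n0 m0 _ Hs); apply: leq_trans n1.
rewrite (Pr_comp p fF (@shift_level_inj 1)).
rewrite (Pr_indep_all p (iota_uniq 0 2) fE (depends_on_column n0 m0 k (2 * m))); last first.
  by move=> i j x /eqP ij /= xi xj; apply: ij; rewrite -xi -xj.
rewrite /= !big_cons big_nil mulr1 !(Pr_comp p fh (@translate_inj n m _ 0)) -expr2.
apply: lerXn2r; rewrite ?nnegrE; [exact: Pr_ge0| |exact: Pr_h_cross_tall].
by rewrite mulr_ge0 ?addr_ge0 // Pr_ge0 //; apply: finsupp_h_cross.
Qed.

(** Below the threshold the quadratic recursion halves the sum at each level, so the sum would tend
    to 0 and fall below [e]. *)
Lemma positive_lower_bound (n m K : nat) (p : R) : (1 < n)%N -> (1 < m)%N -> 0 <= p <= 1 ->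
  positive p (fun k => h_cross n m k 1 1 predT predT) ->
  (16 * (maxn n m)%:R ^+ 2)^-1 <= Pr p (h_cross n m K 1 2 predT predT) +
    Pr p (h_cross m n K 1 2 predT predT).
Proof.
move=> n1 m1 p01 [e e0 He].
have n0 : (0 < n)%N := ltnW n1; have m0 : (0 < m)%N := ltnW m1.
set M : R := (maxn n m)%:R; have M1 : 1 <= M by rewrite ler1n; lia.
have M0 : 0 < M by lra.
pose a k := Pr p (h_cross n m k 1 2 predT predT); pose b k := Pr p (h_cross m n k 1 2 predT predT).
have a0 k : 0 <= a k by rewrite Pr_ge0 //; apply: finsupp_h_cross.
have b0 k : 0 <= b k by rewrite Pr_ge0 //; apply: finsupp_h_cross.
rewrite -/(a K) -/(b K).
have step k : a k.+1 + b k.+1 <= 2 * (2 * M * (a k + b k)) ^+ 2.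
  have H1 := Pr_h_cross_renormalize k n1 m0 p01.
  have H2 := Pr_h_cross_renormalize k m1 n0 p01.
  rewrite -/(a k) -/(b k) -/(a k.+1) -/(b k.+1) in H1 H2.
  have c0 := addr_ge0 (a0 k) (b0 k).
  have bound q : (q <= maxn n m)%N -> ((2 * q)%:R * (a k + b k)) ^+ 2 <= (2 * M * (a k + b k)) ^+ 2.
    move=> qM; rewrite lerXn2r ?nnegrE ?mulr_ge0 ?ler0n //; try lra.
    by rewrite ler_wpM2r // natrM ler_wpM2l // ler_nat.
  have H3 := bound m (leq_maxr n m); have H4 := bound n (leq_maxl n m).
  rewrite [b k + a k]addrC in H2; lra.
rewrite leNgt; apply/negP => cK.
have half0 : 0 <= 2^-1 :> R by lra.
have half1 : 2^-1 <= 1 :> R by lra.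
have dec j : a (K + j)%N + b (K + j)%N <= (a K + b K) * 2^-1 ^+ j.
  elim: j => [|j IH]; first by rewrite addn0 expr0 mulr1.
  rewrite addnS exprS; apply: le_trans (step _) _.
  have c0 := addr_ge0 (a0 (K + j)%N) (b0 (K + j)%N).
  have cj : a (K + j)%N + b (K + j)%N <= (16 * M ^+ 2)^-1.
    apply: le_trans IH _; apply: le_trans (ltW cK).
    by rewrite ler_piMr ?addr_ge0 // exprn_ile1.
  move: IH c0 cj; set c := a _ + b _; set c' := (a K + b K) * 2^-1 ^+ j => IH c0 cj.
  have M2 : 0 < 16 * M ^+ 2 by rewrite mulr_gt0 // exprn_gt0.
  rewrite -[X in X <= _]mul1r in cj.
  have H : 16 * M ^+ 2 * c * c <= 1 * c.
    rewrite ler_wpM2r //; move: cj; rewrite -[_^-1]div1r ler_pdivlMr // mul1r.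
    by rewrite mulrC.
  (* The constant 16 is chosen here: when [c] is at most the threshold, [16 * M ^+ 2 * c] is at most
     1 and only the factor 1/2 remains. *)
  have -> : 2 * (2 * M * c) ^+ 2 = 2^-1 * (16 * M ^+ 2 * c * c) by field.
  have -> : (a K + b K) * (2^-1 * 2^-1 ^+ j) = 2^-1 * c' by rewrite mulrCA.
  by rewrite ler_wpM2l //; lra.
have [J /(_ J (leqnn J)) HJ] := @expr_small R 2^-1 e ltac:(lra) e0.
have ea : e <= a (K + J)%N.
  apply: le_trans (He (K + J)%N) _; apply: Pr_le => //; try exact: finsupp_h_cross.
  by move=> s; apply: h_cross_W.
have c1 : a K + b K <= 1.
  apply: le_trans (ltW cK) _; rewrite invf_le1 ?mulr_gt0 ?exprn_gt0 //.
  have : 1 <= M ^+ 2 by rewrite exprn_ege1.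
  lra.
have := dec J; have := b0 (K + J)%N.
have : (a K + b K) * 2^-1 ^+ J <= 1 * 2^-1 ^+ J.
  by rewrite ler_wpM2r // exprn_ge0.
lra.
Qed.

(** The lower bound does not depend on [p] and survives, at each fixed level, the limit from the
    right, since crossing probabilities are polynomials in [p]. One of the two kinds of crossings is
    then positive at [pc]. Duality used once gives the unit square in the other direction, and used
    twice in the same one. *)
Lemma critical_positive (n m : nat) (pc : R) : (1 < n)%N -> (1 < m)%N -> 0 < pc < 1 ->
  (forall p, pc < p <= 1 -> positive p (fun k => h_cross n m k 1 1 predT predT)) ->
  positive pc (fun k => h_cross n m k 1 1 predT predT) /\
  positive pc (fun k => h_cross m n k 1 1 predT predT).
Proof.
move=> n1 m1 /andP[pc0 pc1] above.
have n0 : (0 < n)%N := ltnW n1; have m0 : (0 < m)%N := ltnW m1.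
have pc01 : 0 <= pc <= 1 by rewrite !ltW.
pose eta : R := (16 * (maxn n m)%:R ^+ 2)^-1.
have eta0 : 0 < eta by rewrite invr_gt0 mulr_gt0 // exprn_gt0 // ltr0n; lia.
pose E (i : bool) k : set (I -> bool) :=
  if i then h_cross n m k 1 2 predT predT else h_cross m n k 1 2 predT predT.
have fE i k : finsupp (E i k) by case: i; apply: finsupp_h_cross.
have bound k : eta <= \sum_(i <- [:: true; false]) Pr pc (E i k).
  rewrite !big_cons big_nil addr0.
  have cf : (Pr p (E true k) + Pr p (E false k)) @[p --> pc^'+] -->
      Pr pc (E true k) + Pr pc (E false k).
    apply: cvg_at_right_filter; apply: cvgD; exact: Pr_continuous.
  apply: (cvgr_to_ge cf); near=> p.
  have pp : pc < p <= 1.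
    by apply/andP; split; near: p; [exact: nbhs_right_gt|exact: nbhs_right_le].
  apply: positive_lower_bound => //; last exact: above.
  by have /andP[/ltW/(le_trans (ltW pc0)) -> ->] := pp.
have dual (n' m' : nat) h : (1 < n')%N -> (1 < m')%N ->
    positive pc (fun k => h_cross n' m' k 1 h predT predT) ->
    positive pc (fun k => h_cross m' n' k 1 1 predT predT).
  by move=> n'1 m'1; apply: positive_crossing_dual.
have [|[] _ pos] := positive_pigeonhole pc01 eta0 fE _ bound.
- by case=> k s; apply: h_cross_antitone.
- by have H := dual _ _ _ n1 m1 pos; split=> //; apply: dual H.
- by have H := dual _ _ _ m1 n1 pos; split=> //; apply: dual H.
Unshelve. all: by end_near.
Qed.

End Renormalization.

(** * From the selection process to the discrete model *)

Section NestedCompacts.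
Context {T : topologicalType} (K : nat -> set T).
Hypotheses (K_compact : compact (K 0%N)) (K_closed : forall k, closed (K k))
  (K_nested : forall k, K k.+1 `<=` K k).

Lemma nested_le k l : (k <= l)%N -> K l `<=` K k.
Proof.
move=> kl; rewrite -(subnK kl); elim: (l - k)%N => [//|j IH].
by rewrite addSn; apply: subset_trans IH; apply: K_nested.
Qed.

Lemma nested_compact_nonempty : (forall k, K k !=set0) -> \bigcap_k K k !=set0.
Proof.
move=> K0; pose F := filter_from [set: nat] K.
have FF : ProperFilter F.
  apply: filter_from_proper => [|k _]; last exact: K0.
  apply: filter_from_filter; first by exists 0%N.
  move=> i j _ _; exists (maxn i j) => // x Kx.
  by split; apply: nested_le Kx; rewrite ?leq_maxl ?leq_maxr.
have [x [_ xF]] := K_compact FF (ex_intro2 _ _ 0%N I (@subset_refl _ _)).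
exists x => k _; have /closure_id -> := @K_closed k.
by move: xF; rewrite clusterE; apply; exists k.
Qed.

End NestedCompacts.

Lemma disjoint_open_separated (T : topologicalType) (U V : set T) :
  open U -> open V -> U `&` V = set0 -> separated U V.
Proof.
move=> Uo Vo UV; split; apply/seteqP; split=> x //= -[].
- move=> xU Vx; have [y [Uy Vy]] := xU V (open_nbhs_nbhs (conj Vo Vx)).
  by have : (U `&` V) y by []; rewrite UV.
- move=> Ux xV; have [y [Vy Uy]] := xV U (open_nbhs_nbhs (conj Uo Ux)).
  by have : (U `&` V) y by []; rewrite UV.
Qed.

(** Two separated pieces of the intersection have disjoint open neighbourhoods. By compactness some
    [K k] lies in their union, and its connectedness excludes one of the pieces. *)
Lemma nested_compact_connected (R : realType) (T : pseudoMetricType R)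
    (K : nat -> set T) :
  compact (K 0%N) -> (forall k, closed (K k)) ->
  (forall k, K k.+1 `<=` K k) -> (forall k, connected (K k)) ->
  connected (\bigcap_k K k).
Proof.
move=> Kc Kcl Kn Kco; apply: contrapT => /connectedPn[E [E0 EK [E1 E2]]].
have Xcl : closed (\bigcap_k K k) by apply: closed_bigI => k _; apply: Kcl.
have Esub b : E b `<=` \bigcap_k K k by rewrite EK; case: b => x; [right|left].
have Ecl b : closed (E b).
  move=> x xE; have : (\bigcap_k K k) x.
    by move: Xcl => /closure_id ->; apply: closure_subset xE; apply: Esub.
  rewrite EK; case: b xE => xE [] // Ex; exfalso.
  - by have : (E false `&` closure (E true)) x by []; rewrite E2.
  - by have : (closure (E false) `&` E true) x by []; rewrite E1.
have [U [V [Uo Vo EU EV UV]]] : exists U V : set T,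
    [/\ open U, open V, E false `<=` U, E true `<=` V & U `&` V = set0].
  apply: (normal_openP (R := R)).1 => //; first exact: pseudometric_normal.
  by apply/seteqP; split=> x // -[E0x /subset_closure E1x]; rewrite -E2; split.
pose L k := K k `&` ~` (U `|` V).
have [k Lk] : exists k, L k = set0.
  apply: contrapT => /forallNP L0.
  have : \bigcap_k L k !=set0.
    apply: nested_compact_nonempty.
    - by apply: compact_closedI => //; apply: open_closedC; apply: openU.
    - by move=> k; apply: closedI => //; apply: open_closedC; apply: openU.
    - by move=> k x [Kx nx]; split=> //; apply: Kn.
    - by move=> k; apply/set0P/eqP/L0.
  case=> x xL; have : (\bigcap_k K k) x by move=> k _; have [] := xL k Logic.I.
  have [_ nUV] := xL 0%N Logic.I.
  by rewrite EK => -[/EU|/EV] ?; apply: nUV; [left|right].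
have KUV : K k `<=` U `|` V.
  move=> x Kx; apply: contrapT => nx.
  by have : L k x by []; rewrite Lk.
have sepUV : separated U V by exact: disjoint_open_separated.
have [KU|KV] := connected_subset sepUV KUV (Kco k).
- have [x Ex] := E0 true; have /KU Ux : K k x by apply: (Esub _ _ Ex k).
  have UVx : (U `&` V) x by split=> //; apply: EV.
  by rewrite UV in UVx.
- have [x Ex] := E0 false; have /KV Vx : K k x by apply: (Esub _ _ Ex k).
  have UVx : (U `&` V) x by split=> //; apply: EU.
  by rewrite UV in UVx.
Qed.

(** The product is a union of crosses, each made of a row and of one fixed column that they all
    share. *)
Lemma connected_setX (U V : topologicalType) (A : set U) (B : set V) :
  connected A -> connected B -> connected (A `*` B).
Proof.
move=> Ac Bc; have [[[x0 y0] [/= Ax0 By0]]|AB0] := pselect (A `*` B !=set0); last first.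
  suff -> : A `*` B = set0 by exact: connected0.
  by apply/seteqP; split=> // z ABz; apply: AB0; exists z.
have row y : connected ((fun x => (x, y)) @` A).
  apply: connected_continuous_connected => //; apply: continuous_subspaceT => x.
  by apply: cvg_pair; [exact: cvg_id|exact: cvg_cst].
have col : connected ((fun y => (x0, y)) @` B).
  apply: connected_continuous_connected => //; apply: continuous_subspaceT => x.
  by apply: cvg_pair; [exact: cvg_cst|exact: cvg_id].
rewrite (_ : A `*` B = \bigcup_(y in B) ((fun y => (x0, y)) @` B `|` (fun x => (x, y)) @` A)).
  apply: bigcup_connected; first by exists (x0, y0) => y By; left; exists y0.
  move=> y By; apply: connectedU => //; exists (x0, y).
  by split; [exists y|exists x0].
apply/seteqP; split=> [[x y] [/= Ax By]|z [y By] [[y' By' <-]|[x Ax <-]]] //.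
by exists y => //; right; exists x.
Qed.

(** * Law of the selected configuration *)

Definition selection_config n m (T : Type) (sel : nat * nat * nat -> set T) (w : T) :
    nat * nat * nat -> bool :=
  fun i => `[< rect_index n m i /\ sel i w >].

Section Law.
Variables (R : realType) (n m : nat) (p : R) (d : measure_display)
  (T : measurableType d) (P : probability T R) (sel : nat * nat * nat -> set T).
Hypothesis hsel : random_selection n m p P sel.
Let I := (nat * nat * nat)%type : choiceType.

Let splice (s : seq I) (y : I -> bool) w i :=
  if i \in s then `[< sel i w >] else y i.

(** The product rule is given only for events that a rectangle is selected. The list [t] collects
    those already imposed, and the case of an unselected rectangle is obtained by subtraction from
    the total. *)
Let splice_cylinder (s t : seq I) (y : I -> bool) (E : set (I -> bool)) :
  uniq (s ++ t) -> (forall i, i \in s ++ t -> rect_index n m i) ->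
  measurable [set w | E (splice s y w)] /\
  P (\bigcap_(i in [set` t]) sel i `&` [set w | E (splice s y w)]) =
    (p ^+ size t * Ex p s \1_E y)%:E.
Proof.
have [sm sp indep] := hsel.
have mT (t' : seq I) : (forall i, i \in t' -> rect_index n m i) ->
    measurable (\bigcap_(i in [set` t']) sel i).
  by move=> H; apply: fin_bigcap_measurable => [|i /= it]; [exact: finite_seq|exact/sm/H].
elim: s t y => [|i s IH] t y /=.
  move=> ut tD; have -> : [set w | E (splice [::] y w)] = [set w | E y] by [].
  have [Ey|Ey] := pselect (E y).
    rewrite (_ : [set w | E y] = setT); last by apply/seteqP; split=> w.
    split=> //; rewrite setIT indicE mem_set // mulr1.
    have tJ : [set` [fset i in t]%fset] = [set` t].
      by apply/seteqP; split=> i /=; rewrite !inE.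
    have -> : size t = size (enum_fset [fset i in t]%fset) by rewrite card_fseq undup_id.
    rewrite -tJ indep; last by rewrite tJ => i /= /tD.
    rewrite (eq_big_seq (fun=> p%:E)); last by move=> i; rewrite !inE /= => /tD/sp.
    by rewrite prodEFin big_const_seq count_predT iter_mulr_1.
  rewrite (_ : [set w | E y] = set0); last by apply/seteqP; split=> w.
  by rewrite setI0 measure0 indicE memNset // mulr0.
move=> /andP[ist ust] stD.
have nis : i \notin s by move: ist; rewrite mem_cat negb_or => /andP[].
have si w b : `[< sel i w >] = b -> splice (i :: s) y w = splice s (upd y i b) w.
  move=> <-; apply/funext => j; rewrite /splice /upd inE.
  by have [->|//] := eqVneq j i; rewrite (negbTE nis).
have iD : rect_index n m i by apply: stD; rewrite mem_head.
have sD j : j \in s ++ t -> rect_index n m j by move=> jt; apply: stD; rewrite inE jt orbT.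
have [m1 P1] := IH t (upd y i true) ust sD.
have [m0 P0] := IH t (upd y i false) ust sD.
have perm_it : perm_eq (s ++ i :: t) (i :: s ++ t) by rewrite -cat1s perm_catCA.
have uit : uniq (s ++ i :: t) by rewrite (perm_uniq perm_it) /= ist.
have itD j : j \in s ++ i :: t -> rect_index n m j by rewrite (perm_mem perm_it); apply: stD.
have [_ P1'] := IH (i :: t) (upd y i true) uit itD.
have [_ P0'] := IH (i :: t) (upd y i false) uit itD.
set A1 := [set w | E (splice s (upd y i true) w)] in m1 P1 P1'.
set A0 := [set w | E (splice s (upd y i false) w)] in m0 P0 P0'.
set S := \bigcap_(j in [set` t]) sel j in P1 P0 *.
have mS : measurable S by apply: mT => j jt; apply: sD; rewrite mem_cat jt orbT.
have mi := sm i iD.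
have ES : \bigcap_(j in [set` i :: t]) sel j = sel i `&` S.
  apply/seteqP; split=> w /= H.
    split=> [|j jt]; first by apply: H; rewrite /= mem_head.
    by apply: H; rewrite /= inE jt orbT.
  by move=> j; rewrite /= inE => /predU1P[->|]; [case: H|case: H => _; apply].
rewrite ES in P1' P0'.
have Esplit : [set w | E (splice (i :: s) y w)] = (sel i `&` A1) `|` (A0 `\` sel i).
  apply/seteqP; split=> w /=.
    have [iw|iw] := pselect (sel i w).
      by rewrite (si w true) ?asboolT //; left.
    by rewrite (si w false) ?asboolF //; right.
  case=> [[iw]|[+ iw]]; first by rewrite (si w true) ?asboolT.
  by rewrite (si w false) ?asboolF.
have m1i : measurable (sel i `&` S `&` A1) by apply: measurableI => //; apply: measurableI.
have m0i : measurable (sel i `&` S `&` A0) by apply: measurableI => //; apply: measurableI.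
have m0S : measurable (S `&` A0) by exact: measurableI.
rewrite Esplit; split.
  by apply: measurableU; [exact: measurableI|exact: measurableD].
rewrite (_ : S `&` _ = (sel i `&` S `&` A1) `|` ((S `&` A0) `\` (sel i `&` S `&` A0))).
  set X := sel i `&` S `&` A1; set Y := sel i `&` S `&` A0.
  have -> : P (X `|` (S `&` A0) `\` Y) = (P X + P ((S `&` A0) `\` Y))%E.
    apply: measureU => //; first exact: measurableD.
    by apply/seteqP; split=> w //= -[[[iw Sw] _] [[_ A0w] nw]]; apply: nw.
  have ltP0 : (P (S `&` A0) < +oo)%E by rewrite P0 ltry.
  have -> : P ((S `&` A0) `\` Y) = (P (S `&` A0) - P (S `&` A0 `&` Y))%E.
    exact: measureD.
  rewrite (_ : S `&` A0 `&` Y = Y); last first.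
    by apply/seteqP; split=> w //=; [case|case=> -[? ?] ?].
  by rewrite P1' P0 P0' -EFinB -EFinD /= exprS; congr EFin; ring.
apply/seteqP; split=> w /=.
  case=> Sw [[iw A1w]|[A0w iw]]; first by left.
  by right; split=> // -[[]].
case=> [[[iw Sw] A1w]|[[Sw A0w] nw]]; first by split=> //; left.
by split=> //; right; split=> // iw; apply: nw.
Qed.

Lemma Pr_selection (E : set (I -> bool)) : finsupp E ->
  depends_on (rect_index n m) E ->
  measurable [set w | E (selection_config n m sel w)] /\
  P [set w | E (selection_config n m sel w)] = (Pr p E)%:E.
Proof.
move=> Ef ED; have [s0 Es0 s0D] := finsupp_restrict Ef ED.
pose s := undup s0; have Es : depends_on [set` s] E.
  by apply: depends_onW Es0 => i /=; rewrite mem_undup.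
have sD i : i \in s ++ [::] -> rect_index n m i.
  by rewrite cats0 mem_undup; apply: s0D.
have us : uniq (s ++ [::]) by rewrite cats0 undup_uniq.
have [mE PE] := splice_cylinder (fun=> false) E us sD.
have eqE : [set w | E (selection_config n m sel w)] = [set w | E (splice s (fun=> false) w)].
  apply/seteqP; split=> w /=;
    rewrite (Es (selection_config n m sel w) (splice s (fun=> false) w)) // => i /= si;
    rewrite /splice /selection_config si; apply/asbool_equiv_eq;
    by have := sD i; rewrite cats0 => /(_ si); split=> [[]|].
rewrite eqE; split=> //; rewrite (PrE p (fun=> false) Es).
by move: PE; rewrite expr0 mul1r set_nil bigcap_set0 setTI.
Qed.

End Law.

(** * Faces as closed intervals *)

Section FaceIntervals.
Variable R : realType.
Implicit Types (n k x N : nat) (t : R).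

(** The closure of the face: [[a, a + 1]] for the code [2 * a] and the point [a + 1] for the code
    [2 * a + 1], in units of the level. *)
Definition face_itv n k x : set R :=
  `[(uphalf x)%:R * n%:R ^- k, (x./2.+1)%:R * n%:R ^- k].

Lemma itv_scale n k (a b : nat) t : (0 < n)%N ->
  (`[a%:R * n%:R ^- k, b%:R * n%:R ^- k]%classic : set R) t <->
  a%:R <= t * (n ^ k)%:R <= b%:R.
Proof.
move=> n0; have nk : 0 < (n ^ k)%:R :> R by rewrite ltr0n expn_gt0 n0.
by rewrite /= in_itv /= natrX in nk *; rewrite ler_pdivrMr // ler_pdivlMr.
Qed.

Lemma face_itv_scale n k x t : (0 < n)%N ->
  face_itv n k x t <-> (uphalf x)%:R <= t * (n ^ k)%:R <= (x./2.+1)%:R.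
Proof. exact: itv_scale. Qed.

Lemma face_itv_coarse n k j x : (0 < n)%N ->
  face_itv n (k + j) x `<=` face_itv n k (coarse (n ^ j) x).
Proof.
move=> n0 t; have d0 : (0 < n ^ j)%N by rewrite expn_gt0 n0.
rewrite !face_itv_scale // half_coarse // uphalf_coarse // expnD natrM mulrA.
have dR : 0 < (n ^ j)%:R :> R by rewrite ltr0n.
move=> /andP[h1 h2]; apply/andP; split.
  rewrite -(ler_pM2r dR); apply: le_trans h1.
  by rewrite -natrM ler_nat leq_trunc_div.
rewrite -(ler_pM2r dR); apply: le_trans h2 _.
by rewrite -natrM ler_nat ltn_ceil.
Qed.

Lemma face_itv_sub n k x a : (0 < n)%N -> (a == x./2) || (a == uphalf x) ->
  face_itv n k x `<=` `[a%:R * n%:R ^- k, a.+1%:R * n%:R ^- k].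
Proof.
move=> n0 ax t; rewrite face_itv_scale // => /andP[h1 h2].
apply/itv_scale => //; apply/andP; split.
  by apply: le_trans h1; rewrite ler_nat; lia.
by apply: le_trans h2 _; rewrite ler_nat; lia.
Qed.

Lemma face_itv_meet n k x y : (0 < n)%N -> (x <= y.+1)%N -> (y <= x.+1)%N ->
  face_itv n k x `&` face_itv n k y !=set0.
Proof.
move=> n0 xy yx; exists ((maxn (uphalf x) (uphalf y))%:R * n%:R ^- k).
have nk : (n ^ k)%:R != 0 :> R by rewrite pnatr_eq0 -lt0n expn_gt0 n0.
by split; apply/face_itv_scale; rewrite // -natrX divfK // !ler_nat; lia.
Qed.

Lemma face_itv_connected n k x : connected (face_itv n k x).
Proof. exact: segment_connected. Qed.

Lemma face_itv_compact n k x : compact (face_itv n k x).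
Proof. exact: segment_compact. Qed.

Lemma face_itv0 n k : (0 < n)%N -> face_itv n k 0 0.
Proof. by move=> n0; apply/face_itv_scale; rewrite // mul0r lexx ler0n. Qed.

Lemma face_itv1 n k : (0 < n)%N -> face_itv n k (2 * (1 * n ^ k) - 2) 1.
Proof.
move=> n0; have nk : (0 < n ^ k)%N by rewrite expn_gt0 n0.
by apply/face_itv_scale; rewrite // mul1r !ler_nat; lia.
Qed.

Lemma face_itv_unit n k x : (0 < n)%N -> (x.+1 < 2 * (1 * n ^ k))%N ->
  exists2 t, face_itv n k x t & `[0, 1]%classic t.
Proof.
move=> n0; rewrite -uphalf_ltn mul1n => xn; exists ((uphalf x)%:R * n%:R ^- k).
  have nk : (n ^ k)%:R != 0 :> R by rewrite pnatr_eq0 -lt0n expn_gt0 n0.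
  by apply/face_itv_scale; rewrite // -natrX divfK // !ler_nat; lia.
have nk : 0 < (n%:R ^+ k) :> R by rewrite exprn_gt0 ?ltr0n.
rewrite /= in_itv /=; apply/andP; split; first by rewrite mulr_ge0 // invr_ge0 ltW.
by rewrite ler_pdivrMr // mul1r -natrX ler_nat ltnW.
Qed.

Let fl N t := minn (Num.truncn (t * N%:R)) N.-1.

(** The code of the face that contains [t], as the sum of the intervals to its left and to its
    right; they differ only at an interior grid point. The cap in [fl] assigns 0 and 1 to the first
    and last open intervals. *)
Definition face_pos N t := (N.-1 - fl N (1 - t) + fl N t)%N.

Let fl_bounds N t : (0 < N)%N -> 0 <= t <= 1 ->
  (N.-1 <= fl N (1 - t) + fl N t <= N)%N.
Proof.
move=> N0 /andP[t0 t1].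
have E : (1 - t) * N%:R = N%:R - t * N%:R by rewrite mulrBl mul1r.
have s0 : 0 <= t * N%:R by rewrite mulr_ge0.
have s1 : 0 <= (1 - t) * N%:R by rewrite mulr_ge0 // subr_ge0.
have /andP[] := truncn_itv s0; have /andP[] := truncn_itv s1.
rewrite /fl E in s1 *; move: (t * N%:R) s0 s1 => s s0 s1.
set a := Num.truncn (_ - _); set b := Num.truncn s => h1 h2 h3 h4.
have u : (a + b <= N)%N by rewrite -(ler_nat R) natrD; lra.
have l : (N < a + b + 2)%N.
  by rewrite -(ltr_nat R) !natrD; move: h2 h4; rewrite -!natr1; lra.
lia.
Qed.

Let face_pos_parts N t : (0 < N)%N -> 0 <= t <= 1 ->
  (face_pos N t)./2 = (N.-1 - fl N (1 - t))%N /\ uphalf (face_pos N t) = fl N t.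
Proof.
move=> N0 t01; have := fl_bounds N0 t01.
by rewrite /face_pos; have := geq_minr (Num.truncn (t * N%:R)) N.-1; rewrite -/(fl N t); lia.
Qed.

Lemma face_pos_lt N t : (0 < N)%N -> 0 <= t <= 1 -> ((face_pos N t).+1 < 2 * N)%N.
Proof.
move=> N0 t01; rewrite -uphalf_ltn; have [_ ->] := face_pos_parts N0 t01.
by rewrite /fl; lia.
Qed.

Lemma face_pos0 N : face_pos N 0 = 0%N.
Proof.
rewrite /face_pos /fl subr0 mul0r mul1r truncn0 natrK min0n.
lia.
Qed.

Lemma face_pos1 N : (0 < N)%N -> face_pos N 1 = (2 * (1 * N) - 2)%N.
Proof.
rewrite /face_pos /fl subrr mul0r mul1r truncn0 natrK min0n.
lia.
Qed.

Let fl_near N t0 : \forall t \near t0, (fl N t <= fl N t0)%N.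
Proof.
have : (t * N%:R) @[t --> t0] --> t0 * N%:R.
  by apply: cvgM; [exact: cvg_id|exact: cvg_cst].
move=> /(_ [set s | s < (Num.truncn (t0 * N%:R)).+1%:R]) H.
have {}H : \forall t \near t0, t * N%:R < (Num.truncn (t0 * N%:R)).+1%:R.
  apply: H; apply: open_nbhs_nbhs; split; first exact: open_lt.
  exact: truncnS_gt.
near=> t; have : t * N%:R < (Num.truncn (t0 * N%:R)).+1%:R by near: t.
rewrite -truncn_le_nat => h; rewrite /fl leq_min geq_minr andbT.
exact: leq_trans (geq_minl _ _) h.
Unshelve. all: by end_near.
Qed.

(** Near [t0] neither [fl N t] nor [fl N (1 - t)] can exceed its value at [t0], so a nearby point
    lies in the same face or in an adjacent one. *)
Lemma face_pos_near N t0 : (0 < N)%N -> 0 <= t0 <= 1 -> \forall t \near t0,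
  0 <= t <= 1 -> ((face_pos N t <= (face_pos N t0).+1) &&
                  (face_pos N t0 <= (face_pos N t).+1))%N.
Proof.
move=> N0 t01.
have H : \forall t \near t0, (fl N (1 - t) <= fl N (1 - t0))%N.
  have : (1 - t) @[t --> t0] --> 1 - t0.
    by apply: cvgB; [exact: cvg_cst|exact: cvg_id].
  by move/(_ _ (fl_near N (1 - t0))).
near=> t => t01'.
have [h1 h2] := face_pos_parts N0 t01; have [h1' h2'] := face_pos_parts N0 t01'.
have l1 : (fl N t <= fl N t0)%N by near: t; exact: fl_near.
have l2 : (fl N (1 - t) <= fl N (1 - t0))%N by near: t.
move: (face_pos N t) (face_pos N t0) h1 h2 h1' h2' l1 l2.
by move: (fl N t) (fl N t0) (fl N (1 - t)) (fl N (1 - t0)); clear; lia.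
Unshelve. all: by end_near.
Qed.

Lemma face_pos_rectangle n j k a t : (0 < n)%N -> (j <= k)%N -> (a < n ^ j)%N ->
  0 <= t <= 1 ->
  (`[a%:R * n%:R ^- j, a.+1%:R * n%:R ^- j]%classic : set R) t ->
  (a = (face_pos (n ^ k) t)./2 %/ n ^ (k - j))%N \/
  (a = uphalf (face_pos (n ^ k) t) %/ n ^ (k - j))%N.
Proof.
move=> n0 jk aj t01; have N0 : (0 < n ^ k)%N by rewrite expn_gt0 n0.
have d0 : (0 < n ^ (k - j))%N by rewrite expn_gt0 n0.
have [-> ->] := face_pos_parts N0 t01.
have EN : (n ^ k = n ^ j * n ^ (k - j))%N by rewrite -expnD subnKC.
rewrite itv_scale // /fl EN; set d := (n ^ (k - j))%N in d0 EN *.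
set A := (n ^ j)%N in aj EN *; move=> /andP[h1 h2].
have /andP[t0 t1] := t01.
have dR : 0 < d%:R :> R by rewrite ltr0n.
have aA : (a.+1 * d <= A * d)%N by rewrite leq_mul2r aj orbT.
have s0 : 0 <= t * (A * d)%:R by rewrite mulr_ge0.
have [h|h] := ltP (t * A%:R) a.+1%:R.
  right; have l1 : (Num.truncn (t * (A * d)%:R) < a.+1 * d)%N.
    by rewrite truncn_lt_nat // !natrM mulrA ltr_pM2r.
  have l2 : (a * d <= Num.truncn (t * (A * d)%:R))%N.
    by rewrite truncn_ge_nat // !natrM mulrA ler_pM2r.
  move: (Num.truncn _) l1 l2 => q l1 l2; rewrite (minn_idPl _); last by lia.
  by apply/eqP; rewrite eqn_leq leq_divRL // l2 -ltnS ltn_divLR.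
(* The point is the right end of the interval [a], which is then its left neighbour. *)
left; have tA : t * A%:R = a.+1%:R by apply/eqP; rewrite eq_le h2 h.
have -> : (1 - t) * (A * d)%:R = ((A - a.+1) * d)%:R.
  by rewrite !natrM natrB // mulrBl mul1r mulrA tA mulrBl.
rewrite natrK (minn_idPl _); last first.
  by rewrite mulnBl; move: aA; rewrite mulSn; lia.
have -> : ((A * d).-1 - (A - a.+1) * d = a * d + d.-1)%N.
  by rewrite mulnBl; move: aA; rewrite mulSn; lia.
by rewrite divnMDl // divn_small ?addn0 // prednK.
Qed.

End FaceIntervals.

(** * Crossings of the carpet and of its approximations *)

Section CarpetFaces.
Variables (R : realType) (n m : nat) (T : Type) (sel : nat * nat * nat -> set T) (w : T).
Hypotheses (n_gt0 : (0 < n)%N) (m_gt0 : (0 < m)%N).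
Let nk k : (0 < n ^ k)%N. Proof. by rewrite expn_gt0 n_gt0. Qed.
Let mk k : (0 < m ^ k)%N. Proof. by rewrite expn_gt0 m_gt0. Qed.
Let s := selection_config n m sel w.
Let F : set (R * R) := carpet n m sel w.
Let A k := open_in_box n m k 1 1 s.
Implicit Types (k : nat) (u v : nat * nat) (z : R * R).

Definition face k v : set (R * R) := face_itv n k v.1 `*` face_itv m k v.2.

Definition face_at k z := (face_pos (n ^ k) z.1, face_pos (m ^ k) z.2).

Lemma carpet_unit z : F z -> (0 <= z.1 <= 1) && (0 <= z.2 <= 1).
Proof.
move=> /(_ 1%N (leqnn _))[[[j a] b] [[/= j1 aj bj] jE _]].
have E q c (t : R) : (0 < q)%N -> (c < q ^ j)%N ->
    (`[c%:R * q%:R ^- j, c.+1%:R * q%:R ^- j]%classic : set R) t -> 0 <= t <= 1.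
  move=> q0 cq /(itv_scale _ _ _ _ q0) /andP[h1 h2].
  have qj : 0 < (q ^ j)%:R :> R by rewrite ltr0n expn_gt0 q0.
  rewrite -(pmulr_lge0 _ qj) (le_trans _ h1) //=.
  by rewrite -(ler_pM2r qj) mul1r (le_trans h2) // ler_nat.
by case=> /(E _ _ _ n_gt0 aj) -> /(E _ _ _ m_gt0 bj) ->.
Qed.

Lemma carpet_face_open k z : F z -> A k (face_at k z).
Proof.
move=> Fz; have /andP[z1 z2] := carpet_unit Fz.
apply/and3P; split; rewrite ?mul1n ?face_pos_lt //.
apply/face_openP => // l /andP[l0 lk].
have [[[j a] b] [[/= _ al bl] /= jl selw] [/= az bz]] := Fz l l0; subst j.
have sab : s (l, a, b) by apply/asboolP; split=> //; split.
rewrite /face_selected !half_coarse // !uphalf_coarse //.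
have [<-|<-] := face_pos_rectangle n_gt0 lk al z1 az;
have [<-|<-] := face_pos_rectangle m_gt0 lk bl z2 bz; by rewrite sab ?orbT.
Qed.

Lemma face_at_near k z0 : F z0 ->
  \forall z \near z0, F z -> king (face_at k z0) (face_at k z).
Proof.
move=> /carpet_unit /andP[z1 z2].
have N1 := face_pos_near (nk k) z1; have N2 := face_pos_near (mk k) z2.
have c1 : z.1 @[z --> z0] --> z0.1 by exact: cvg_fst.
have c2 : z.2 @[z --> z0] --> z0.2 by exact: cvg_snd.
near=> z => /carpet_unit/andP[u1 u2].
have k1 : ((face_pos (n ^ k) z.1 <= (face_pos (n ^ k) z0.1).+1) &&
  (face_pos (n ^ k) z0.1 <= (face_pos (n ^ k) z.1).+1))%N.
  by move: u1; near: z; exact: (c1 _ N1).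
have k2 : ((face_pos (m ^ k) z.2 <= (face_pos (m ^ k) z0.2).+1) &&
  (face_pos (m ^ k) z0.2 <= (face_pos (m ^ k) z.2).+1))%N.
  by move: u2; near: z; exact: (c2 _ N2).
by rewrite /king /=; lia.
Unshelve. all: by end_near.
Qed.

(** Nearby points of the carpet have king-adjacent faces, so the points of [C] whose face is joined
    to that of [x] form a relatively open and closed subset. *)
Lemma connected_faces k (C : set (R * R)) x y : connected C -> C `<=` F ->
  C x -> C y -> conn (A k) (face_at k x) (face_at k y).
Proof.
move=> Cc CF Cx Cy.
pose P z := conn (A k) (face_at k x) (face_at k z).
have near_P z0 : C z0 -> \forall z \near z0, C z -> (P z <-> P z0).
  move=> Cz0; have near_king := face_at_near k (CF _ Cz0).
  near=> z => Cz.
  have kz : king (face_at k z0) (face_at k z).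
    by move: (CF _ Cz); near: z; exact: near_king.
  have Az := carpet_face_open k (CF _ Cz); have Az0 := carpet_face_open k (CF _ Cz0).
  split=> Pz; first by apply: conn_rcons Pz _ Az0; rewrite king_sym.
  exact: conn_rcons Pz kz Az.
suff : C `&` P = C by move=> CP; have [] : (C `&` P) y by rewrite CP.
apply: Cc.
- by exists x; split=> //; apply/conn_refl/carpet_face_open/CF.
- exists (interior [set z | C z -> P z]); first exact: open_interior.
  apply/seteqP; split=> z [Cz Pz]; split=> //; last exact: interior_subset Pz Cz.
  by apply: filterS (near_P _ Cz) => z' H /H [_]; apply.
- exists (~` interior [set z | C z -> ~ P z]).
    exact/open_closedC/open_interior.
  apply/seteqP; split=> z [Cz Pz]; split=> //.
    by move=> /interior_subset /(_ Cz).
  apply: contrapT => nPz; apply: Pz.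
  by apply: filterS (near_P _ Cz) => z' H /H [Hz _] /Hz.
Unshelve. all: by end_near.
Qed.

Lemma face_compact k v : compact (face k v).
Proof. by apply: compact_setX; apply: face_itv_compact. Qed.

Lemma face_closed k v : closed (face k v).
Proof. by apply: compact_closed; [exact: norm_hausdorff|exact: face_compact]. Qed.

Lemma face_connected k v : connected (face k v).
Proof. by apply: connected_setX; apply: face_itv_connected. Qed.

Lemma face_coarse k v : face k.+1 v `<=` face k (coarse (n ^ 1) v.1, coarse (m ^ 1) v.2).
Proof.
by rewrite -addn1 => z [z1 z2]; split; apply: face_itv_coarse.
Qed.

Lemma face_king k u v : king u v -> face k u `&` face k v !=set0.
Proof.
move=> /and4P[h1 h2 h3 h4].
have [x [x1 x2]] := @face_itv_meet R n k _ _ n_gt0 h1 h2.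
have [y [y1 y2]] := @face_itv_meet R m k _ _ m_gt0 h3 h4.
by exists (x, y).
Qed.

Lemma face_carpet k v z : A k v -> face k v z -> (0 < k)%N ->
  selected_union n m sel k w z.
Proof.
move=> /and3P[/face_openP vo _ _] [z1 z2] k0.
have := vo n_gt0 m_gt0 k; rewrite k0 leqnn subnn !expn0 !coarse1 => /(_ isT).
have H a b : (a == v.1./2) || (a == uphalf v.1) -> (b == v.2./2) || (b == uphalf v.2) ->
    s (k, a, b) -> selected_union n m sel k w z.
  move=> av bv /asboolP[kab selw]; exists (k, a, b) => //.
  by split=> /=; [exact: face_itv_sub av _ z1|exact: face_itv_sub bv _ z2].
by case/or4P; apply: H; rewrite eqxx ?orbT.
Qed.

Lemma finite_faces k (D : set (nat * nat)) : (forall v, D v -> A k v) -> finite_set D.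
Proof.
move=> DA; apply: (sub_finite_set (B := [set` [seq (x, y) | x <- iota 0 (2 * (1 * n ^ k)),
  y <- iota 0 (2 * (1 * m ^ k))]])); last exact: finite_seq.
move=> v /DA/and3P[_ v1 v2] /=; apply/allpairsP; exists v.
by rewrite !mem_iota /= (ltnW v1) (ltnW v2); case: v {v1 v2}.
Qed.

Lemma connected_chain k u :
  A k u -> connected (\bigcup_(v in [set v | conn (A k) u v]) face k v).
Proof.
move=> Au; set U := \bigcup_(v in _) _.
pose D := [set C : set (R * R) | [/\ connected C, face k u `<=` C & C `<=` U]].
have DU v : conn (A k) u v -> exists2 C, D C & face k v `<=` C.
  move: v; apply: conn_ind => [|v v' uv [C [Cc uC CU] vC] vv' Av'].
    exists (face k u) => //; split=> //; first exact: face_connected.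
    by move=> z zu; exists u => //; apply: conn_refl.
  exists (C `|` face k v'); last by move=> z; right.
  split.
  - apply: connectedU => //; last exact: face_connected.
    by have [z [zv zv']] := face_king k vv'; exists z; split=> //; apply: vC.
  - by move=> z /uC; left.
  - move=> z [/CU//|zv']; exists v' => //; exact: conn_rcons uv vv' Av'.
rewrite (_ : U = \bigcup_(C in D) C).
  apply: bigcup_connected => [|C []//].
  have [z [zu _]] : face k u `&` face k u !=set0 by apply: face_king; rewrite /king !leqnSn.
  by exists z => C [_ + _]; apply.
apply/seteqP; split=> z; last by case=> C [_ _ CU] /CU.
by case=> v /= /DU[C DC vC] /vC Cz; exists C.
Qed.

(** A compactness argument in two stages: first a point of [X] that, at every level, lies in a face
    joined to the target; then the decreasing intersection of the clusters around this point, which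
    is connected, lies in the carpet and meets [Y]. *)
Lemma limit_crossing (X Y : set (R * R)) (S Q : nat -> pred (nat * nat)) :
  closed X -> closed Y ->
  (forall k v, A k v -> S k v -> face k v `&` X !=set0) ->
  (forall k v, A k v -> Q k v -> face k v `&` Y !=set0) ->
  (forall k v, Q k.+1 v -> Q k (coarse (n ^ 1) v.1, coarse (m ^ 1) v.2)) ->
  (forall k, exists u v, [/\ S k u, Q k v & conn (A k) u v]) ->
  connected_in F X Y.
Proof.
move=> Xcl Ycl SX QY Qcoarse cross.
pose good k := [set u | exists2 v, Q k v & conn (A k) u v].
have good_coarse k u : good k.+1 u -> good k (coarse (n ^ 1) u.1, coarse (m ^ 1) u.2).
  move=> [v Qv uv]; exists (coarse (n ^ 1) v.1, coarse (m ^ 1) v.2).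
    exact: Qcoarse.
  exact: conn_coarse.
pose B k := \bigcup_(u in good k) face k u.
have closed_faces k D : (forall v, D v -> A k v) -> closed (\bigcup_(v in D) face k v).
  by move=> /finite_faces Df; apply: closed_bigcup => // v _; apply: face_closed.
have compact_faces D (Z : set (R * R)) : (forall v, D v -> A 0 v) -> closed Z ->
    compact ((\bigcup_(v in D) face 0 v) `&` Z).
  move=> DA Zcl; apply: compact_closedI => //.
  apply: subclosed_compact (closed_faces _ _ DA) (@face_compact 0%N (0%N, 0%N)) _.
  move=> z [[x y] /DA/and3P[_ /= x0 y0]]; rewrite !expn0 in x0 y0.
  by have [-> ->] : x = 0%N /\ y = 0%N by lia.
have [x1 Kx1] : \bigcap_k (B k `&` X) !=set0.
  apply: nested_compact_nonempty.
  - by apply: compact_faces => // v [v' _ /conn_in[]].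
  - by move=> k; apply: closedI => //; apply: closed_faces => v [v' _ /conn_in[]].
  - move=> k z [[u gu uz] Xz]; split=> //.
    by exists (coarse (n ^ 1) u.1, coarse (m ^ 1) u.2); [exact: good_coarse|exact: face_coarse].
  - move=> k; have [u [v [Su Qv uv]]] := cross k.
    have [Au _] := conn_in uv.
    by have [z [uz Xz]] := SX _ _ Au Su; exists z; split=> //; exists u => //; exists v.
(* The point may lie in several closed faces. All of them are kept: the sets then decrease with the
   level, and their clusters have [x1] in common. *)
pose start k := [set u | good k u /\ face k u x1].
pose D k := [set v | exists2 u, start k u & conn (A k) u v].
have DA k v : D k v -> A k v by move=> [u _ /conn_in[]].
pose K k := \bigcup_(v in D k) face k v.
have Kcl k : closed (K k) by exact/closed_faces/DA.
have D_coarse k v : D k.+1 v -> D k (coarse (n ^ 1) v.1, coarse (m ^ 1) v.2).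
  move=> [u [gu ux] uv]; exists (coarse (n ^ 1) u.1, coarse (m ^ 1) u.2).
    by split; [exact: good_coarse|exact: face_coarse].
  exact: conn_coarse.
have Kn k : K k.+1 `<=` K k.
  move=> z [v /D_coarse Dv vz]; eexists; first exact: Dv.
  exact: face_coarse.
have Kx k : exists2 u, start k u & A k u.
  by have [[u gu ux] _] := Kx1 k Logic.I; exists u => //; case: gu => v _ /conn_in[].
have Kco k : connected (K k).
  rewrite (_ : K k = \bigcup_(u in start k) \bigcup_(v in [set v | conn (A k) u v]) face k v).
    apply: bigcup_connected.
      exists x1 => u [gu ux]; exists u => //=; apply: conn_refl.
      by case: gu => v _ /conn_in[].
    by move=> u [[v _ /conn_in[Au _]] _]; apply: connected_chain.
  apply/seteqP; split=> z.
    by move=> [v [u su uv] vz]; exists u => //; exists v.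
  by move=> [u su [v uv vz]]; exists v => //; exists u.
have K0 : compact (K 0%N).
  by have := compact_faces _ _ (DA 0%N) closedT; rewrite setIT.
have C_connected := nested_compact_connected K0 Kcl Kn Kco.
have [x2 Kx2] : \bigcap_k (K k `&` Y) !=set0.
  apply: nested_compact_nonempty.
  - exact/compact_faces/Ycl/DA.
  - by move=> k; apply: closedI.
  - by move=> k z [/Kn].
  - move=> k; have [u su _] := Kx k; have [[v Qv uv] _] := su.
    have [_ Av] := conn_in uv.
    by have [z [vz Yz]] := QY _ _ Av Qv; exists z; split=> //; exists v => //; exists u.
have CF : \bigcap_k K k `<=` F.
  move=> z Kz j /= j0; have [v Dv vz] := Kz j Logic.I.
  exact: face_carpet (DA _ _ Dv) vz j0.
have Cx1 : (\bigcap_k K k) x1.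
  by move=> k _; have [u su Au] := Kx k; exists u; [exists u => //; exact: conn_refl|case: su].
have Cx2 : (\bigcap_k K k) x2 by move=> k kT; have [] := Kx2 k kT.
exists x1, x2; split.
- by split; [case: (Kx1 0%N Logic.I)|exact: CF].
- by split; [case: (Kx2 0%N Logic.I)|exact: CF].
- by exists (\bigcap_k K k).
Qed.

Lemma carpet_component x y : connected_component F x y ->
  exists C, [/\ connected C, C `<=` F, C x & C y].
Proof. by move=> [C [Cx CF Cc] Cy]; exists C. Qed.

Lemma H_crossing_carpetP :
  H_crossing F <-> forall k, h_cross n m k 1 1 predT predT s.
Proof.
split=> [[x1 [x2 [[[x10 _] _] [[x21 _] _] /carpet_component[C [Cc CF C1 C2]]]]] k|H].
  have := connected_faces k Cc CF C1 C2; exists (face_at k x1), (face_at k x2).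
  by split=> //=; [rewrite x10 face_pos0|rewrite x21 face_pos1].
apply: (@limit_crossing _ _ (fun k v => v.1 == 0%N) (fun k v => v.1 == 2 * (1 * n ^ k) - 2)%N).
- apply: compact_closed; first exact: norm_hausdorff.
  by apply: compact_setX; [exact: compact_set1|exact: segment_compact].
- apply: compact_closed; first exact: norm_hausdorff.
  by apply: compact_setX; [exact: compact_set1|exact: segment_compact].
- move=> k v /and3P[_ _ v2] /eqP v0; have [y yv y01] := @face_itv_unit R m k _ m_gt0 v2.
  by exists (0, y); split; split; rewrite //= v0; apply: face_itv0.
- move=> k v /and3P[_ _ v2] /eqP v1; have [y yv y01] := @face_itv_unit R m k _ m_gt0 v2.
  by exists (1, y); split; split; rewrite //= v1; apply: face_itv1.
- by move=> k v /eqP ->; rewrite /= coarse_last_expn.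
- move=> k; have [u [v [u0 v1 _ _ uv]]] := H k.
  by exists u, v; rewrite u0 v1.
Qed.

Lemma V_crossing_carpetP :
  V_crossing F <-> forall k, v_cross n m k 1 1 s.
Proof.
split=> [[x1 [x2 [[[_ x10] _] [[_ x21] _] /carpet_component[C [Cc CF C1 C2]]]]] k|H].
  have := connected_faces k Cc CF C1 C2 => c12.
  apply/v_crossP => //; exists (face_at k x1), (face_at k x2).
  by split=> //=; [rewrite x10 face_pos0|rewrite x21 face_pos1].
apply: (@limit_crossing _ _ (fun k v => v.2 == 0%N) (fun k v => v.2 == 2 * (1 * m ^ k) - 2)%N).
- apply: compact_closed; first exact: norm_hausdorff.
  by apply: compact_setX; [exact: segment_compact|exact: compact_set1].
- apply: compact_closed; first exact: norm_hausdorff.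
  by apply: compact_setX; [exact: segment_compact|exact: compact_set1].
- move=> k v /and3P[_ v1 _] /eqP v0; have [x xv x01] := @face_itv_unit R n k _ n_gt0 v1.
  by exists (x, 0); split; split; rewrite //= v0; apply: face_itv0.
- move=> k v /and3P[_ v1 _] /eqP v2; have [x xv x01] := @face_itv_unit R n k _ n_gt0 v1.
  by exists (x, 1); split; split; rewrite //= v2; apply: face_itv1.
- by move=> k v /eqP ->; rewrite /= coarse_last_expn.
- move=> k; have /v_crossP[//|//|u [v [u0 v1 uv]]] := H k.
  by exists u, v; rewrite u0 v1.
Qed.

End CarpetFaces.

(** * Decreasing limits of crossing probabilities *)

Lemma Pr_cvg_crossing (R : realType) (n m : nat) (p : R) (d : measure_display)
    (T : measurableType d) (P : probability T R) (sel : nat * nat * nat -> set T)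
    (G : set T) (E : nat -> set (nat * nat * nat -> bool)) :
  random_selection n m p P sel ->
  (forall k, finsupp (E k)) -> (forall k, depends_on (rect_index n m) (E k)) ->
  (forall k, E k.+1 `<=` E k) ->
  (forall w, G w <-> forall k, E k (selection_config n m sel w)) ->
  Pr p (E k) @[k --> \oo] --> fine (P G).
Proof.
move=> hsel Ef ED Ed GE.
pose X k := [set w | E k (selection_config n m sel w)].
have PX k := Pr_selection hsel (Ef k) (ED k).
have -> : G = \bigcap_k X k.
  by apply/seteqP; split=> w; [move=> /GE H k _; apply: H|move=> H; apply/GE => k; apply: H].
have XE : fine \o (P \o X) = fun k => Pr p (E k).
  by apply/funext => k; rewrite /= (PX k).2.
rewrite -XE; apply: fine_cvg; rewrite fineK.
  apply: nonincreasing_cvg_mu.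
  - by rewrite ltey_eq fin_num_measure //; have [] := PX 0%N.
  - by move=> k; have [] := PX k.
  - by apply: bigcapT_measurable => k; have [] := PX k.
  - apply/nonincreasing_seqP => k; apply/subsetPset => w; exact: Ed.
apply: fin_num_measure; apply: bigcapT_measurable => k; by have [] := PX k.
Qed.

Section LimitFunction.
Variables (R : realType) (E : nat -> set (nat * nat * nat -> bool)) (theta : R -> R).
Hypotheses (Ef : forall k, finsupp (E k)) (Ei : forall k, isotone_event (E k))
  (Ed : forall k, E k.+1 `<=` E k)
  (theta_lim : forall p : R, 0 <= p <= 1 -> Pr p (E k) @[k --> \oo] --> theta p).

Lemma limit_le p k : 0 <= p <= 1 -> theta p <= Pr p (E k).
Proof.
move=> p01; apply: (cvgr_to_le (theta_lim p01)).
by near=> l; apply: Pr_antitone => //; near: l; exact: nbhs_infty_ge.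
Unshelve. all: by end_near.
Qed.

Lemma limit_nondecreasing : {in `[0, 1] &, {homo theta : p q / p <= q}}.
Proof.
move=> p q; rewrite !in_itv /= => p01 q01 pq.
apply: (ler_cvg_to (theta_lim p01) (theta_lim q01)).
have /andP[p0 _] := p01; have /andP[_ q1] := q01.
by near=> k; apply: Pr_le_p.
Unshelve. all: by end_near.
Qed.

(** A decreasing limit of continuous functions is upper semicontinuous; with monotonicity in [p]
    this gives continuity from the right. *)
Lemma limit_right_continuous : right_continuous_on01 theta.
Proof.
move=> p /andP[p0 p1]; have p01 : 0 <= p <= 1 by rewrite p0 ltW.
apply/cvgrPdist_lt => e e0.
have [k Hk] : exists k, Pr p (E k) < theta p + e.
  have /cvgrPdist_lt/(_ e e0) [k _ /(_ k (leqnn k))] := theta_lim p01.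
  by move=> /=; rewrite ltr_norml => /andP[h _]; exists k; lra.
have H : \forall q \near p^'+, Pr q (E k) < theta p + e.
  have cf : Pr q (E k) @[q --> p^'+] --> Pr p (E k).
    by apply: cvg_at_right_filter; apply: Pr_continuous.
  exact: (cvgr_lt _ cf).
near=> q; have q01 : 0 <= q <= 1.
  apply/andP; split; last by near: q; exact: nbhs_right_le.
  by apply: le_trans p0 _; near: q; exact: nbhs_right_ge.
have pq : p <= q by near: q; exact: nbhs_right_ge.
have h1 : Pr q (E k) < theta p + e by near: q.
have h2 := limit_le k q01.
have h3 : theta p <= theta q by apply: limit_nondecreasing; rewrite ?in_itv.
by rewrite ler0_norm; lra.
Unshelve. all: by end_near.
Qed.

Lemma limit_gt0 p : 0 <= p <= 1 -> (0 < theta p <-> positive p E).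
Proof.
move=> p01; split=> [t0|[e e0 He]].
  by exists (theta p) => // k; apply: limit_le.
apply: lt_le_trans e0 _; apply: (cvgr_to_ge (theta_lim p01)).
by near=> k.
Unshelve. all: by end_near.
Qed.

End LimitFunction.

Lemma depends_on_rect_index (n m k : nat) : (0 < n)%N -> (0 < m)%N ->
  depends_on (rect_index n m) (h_cross n m k 1 1 predT predT).
Proof.
move=> n0 m0 s t st; apply/propext; split; apply: h_cross_depends => // l a b /andP[l0 _];
  rewrite !mul1n => al bl; [|apply/esym]; by apply: st; split.
Qed.

Lemma depends_on_rect_index_v (n m k : nat) : (0 < n)%N -> (0 < m)%N ->
  depends_on (rect_index n m) (v_cross n m k 1 1).
Proof.
move=> n0 m0 s t st; apply: depends_on_rect_index => // i [l0 al bl].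
by apply: st; split.
Qed.

Unset Implicit Arguments.
Set Strict Implicit.
Set Printing Implicit Defensive.

Theorem theorem2p4 (R : realType) (m n : nat) (hn : (2 <= n)%N) (hmn : (n < m)%N)
    (d : R -> measure_display)
    (T : forall p : R, measurableType (d p))
    (P : forall p : R, probability (T p) R)
    (sel : forall p : R, nat * nat * nat -> set (T p))
    (hsel : forall p : R, 0 <= p <= 1 -> random_selection n m p (P p) (sel p))
    (pC : R)
    (hpH : is_critical_probability (theta_H n m P sel) pC)
    (hpV : is_critical_probability (theta_V n m P sel) pC) :
  [/\ right_continuous_on01 (theta_H n m P sel)
        /\ {in `[0, 1] &, {homo theta_H n m P sel : p q / p <= q}},
      right_continuous_on01 (theta_V n m P sel)
        /\ {in `[0, 1] &, {homo theta_V n m P sel : p q / p <= q}},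
      forall p : R, 0 <= p < pC ->
        theta_H n m P sel p = 0 /\ theta_V n m P sel p = 0
    & forall p : R, pC <= p <= 1 ->
        0 < theta_H n m P sel p /\ 0 < theta_V n m P sel p].
Proof.
have m1 : (1 < m)%N := ltn_trans hn hmn.
have n0 : (0 < n)%N := ltnW hn; have m0 : (0 < m)%N := ltnW m1.
pose H k : set (nat * nat * nat -> bool) := h_cross n m k 1 1 predT predT.
pose V k : set (nat * nat * nat -> bool) := v_cross n m k 1 1.
have fH k : finsupp (H k) by exact: finsupp_h_cross.
have fV k : finsupp (V k) by exact: finsupp_v_cross.
have iH k : isotone_event (H k) by exact: isotone_h_cross.
have iV k : isotone_event (V k).
  exact: (@isotone_event_comp _ transpose _ (@isotone_h_cross m n m0 n0 k 1 1 predT predT)).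
have dH k : H k.+1 `<=` H k by move=> s; apply: h_cross_antitone.
have dV k : V k.+1 `<=` V k by move=> s; apply: h_cross_antitone.
have limH (p : R) : 0 <= p <= 1 -> Pr p (H k) @[k --> \oo] --> theta_H n m P sel p.
  move=> p01; rewrite /theta_H; apply: (Pr_cvg_crossing (hsel p p01) fH _ dH) => [k|w].
    exact: depends_on_rect_index.
  exact: H_crossing_carpetP.
have limV (p : R) : 0 <= p <= 1 -> Pr p (V k) @[k --> \oo] --> theta_V n m P sel p.
  move=> p01; rewrite /theta_V; apply: (Pr_cvg_crossing (hsel p p01) fV _ dV) => [k|w].
    exact: depends_on_rect_index_v.
  exact: V_crossing_carpetP.
have [pC01 H0 H1] := hpH; have [_ V0 V1] := hpV.
split.
- split; [exact: limit_right_continuous fH iH dH limH|exact: limit_nondecreasing limH].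
- split; [exact: limit_right_continuous fV iV dV limV|exact: limit_nondecreasing limV].
- by move=> p p0; split; [exact: H0|exact: V0].
- move=> p /andP[]; rewrite le_eqVlt => /predU1P[<- _|pCp p1]; last first.
    by split; [apply: H1|apply: V1]; rewrite pCp.
  have /andP[/ltW pC0 /ltW pC1] := pC01.
  have pC01' : 0 <= pC <= 1 by rewrite pC0.
  have [|posH posV] := @critical_positive R n m pC hn m1 pC01.
    move=> q /andP[pCq q1]; apply/(limit_gt0 fH dH limH); last by apply: H1; rewrite pCq.
    by rewrite (le_trans pC0 (ltW pCq)).
  split; first exact/(limit_gt0 fH dH limH).
  apply/(limit_gt0 fV dV limV) => //.
  (* [posV] concerns the model with [n] and [m] exchanged, whose horizontal crossings have the
     probabilities of the vertical ones. *)
  case: posV => e e0 He; exists e => // k.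
  by rewrite (Pr_v_cross m0 n0).
Qed.
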